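(* Let $(R,\mathfrak m)$ be a Cohen-Macaulay local ring of dimension $d$ with $1\leq d\leq 2$ and infinite residue field, and let $I,J$ be $\mathfrak m$-primary ideals of $R$. Let $\mathcal F=\{\mathcal F(r,s)\}_{r,s\in\mathbb Z}$ be a $\mathbb Z^2$-graded $(I,J)$-admissible filtration of ideals in $R$. Then the following statements are equivalent. (1) $e_{(d-1)e_i}(\mathcal F)=0$ for $i=1,2$. (2) $I$ and $J$ are each generated by a system of parameters, $P_{\mathcal F}(r,s)=H_{\mathcal F}(r,s)$ for all $r,s\in\mathbb N$, and $\mathcal F(r,s)=I^rJ^s$ for all $r,s\in\mathbb Z$. (3) $e_\alpha(\mathcal F)=0$ for all $\alpha\in\mathbb N^2$ with $|\alpha|\leq d-1$.
   Context: Notation: $\mathbb N=\{0,1,2,\ldots\}$, $\lambda$ denotes length over $R$, $e_1=(1,0)$, $e_2=(0,1)$; inequalities in $\mathbb Z^2$ are componentwise; $|\alpha|=\alpha_1+\alpha_2$; a nonpositive power of an ideal is $R$. A $\mathbb Z^2$-graded $(I,J)$-admissible filtration is a family of ideals $\mathcal F=\{\mathcal F(\underline n)\}_{\underline n\in\mathbb Z^2}$ of $R$ such that for all $\underline n=(r,s),\underline m\in\mathbb Z^2$: $I^{r}J^{s}\subseteq\mathcal F(r,s)$; $\mathcal F(\underline n)\mathcal F(\underline m)\subseteq\mathcal F(\underline n+\underline m)$; $\mathcal F(\underline m)\subseteq\mathcal F(\underline n)$ if $\underline m\ge\underline n$; $\mathcal F(r,s)=\mathcal F(\max(r,0),\max(s,0))$;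 and $\bigoplus_{(r,s)\in\mathbb Z^2}\mathcal F(r,s)t_1^rt_2^s$ is a finite module over $\bigoplus_{(r,s)\in\mathbb Z^2}I^rJ^st_1^rt_2^s$ ($t_1,t_2$ indeterminates). $H_{\mathcal F}(r,s)=\lambda(R/\mathcal F(r,s))$; $P_{\mathcal F}$ is the polynomial of degree $d$ with $P_{\mathcal F}(r,s)=H_{\mathcal F}(r,s)$ for all $r,s\gg0$, written $$P_{\mathcal F}(r,s)=\sum_{\alpha\in\mathbb N^2,\ |\alpha|\le d}(-1)^{d-|\alpha|}e_\alpha(\mathcal F)\binom{r+\alpha_1-1}{\alpha_1}\binom{s+\alpha_2-1}{\alpha_2},$$ with integers $e_\alpha(\mathcal F)$, the Hilbert coefficients. *)

(* Defs.v *)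
From HB Require Import structures.
From mathcomp Require Import all_boot all_order all_algebra.
From mathcomp Require Import boolp classical_sets functions cardinality fsbigop.

Set Implicit Arguments.
Unset Strict Implicit.
Unset Printing Implicit Defensive.

Import Order.TTheory GRing.Theory Num.Theory.

Local Open Scope classical_set_scope.
Local Open Scope ring_scope.

Definition is_ideal (R : comNzRingType) (A : set R) : Prop :=
  [/\ A 0,
      forall x y, A x -> A y -> A (x + y)
    & forall a x, A x -> A (a * x)].

Definition ideal_gen (R : comNzRingType) (S : set R) : set R :=
  smallest (@is_ideal R) S.

Definition ideal_mul (R : comNzRingType) (A B : set R) : set R :=
  ideal_gen [set a * b | a in A & b in B].

Definition ideal_exp (R : comNzRingType) (A : set R) (n : nat) : set R :=
  iter n (ideal_mul A) setT.

(* Nonpositive powers are the unit ideal. *)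
Definition ideal_expz (R : comNzRingType) (A : set R) (z : int) : set R :=
  match z with
  | Posz n => ideal_exp A n
  | Negz _ => setT
  end.

Definition prime_ideal (R : comNzRingType) (P : set R) : Prop :=
  [/\ is_ideal P, ~ P 1 & forall x y, P (x * y) -> P x \/ P y].

Definition maximal_ideal (R : comNzRingType) (M : set R) : Prop :=
  [/\ is_ideal M, M <> setT
    & forall A, is_ideal A -> M `<=` A -> A = M \/ A = setT].

Definition primary_ideal (R : comNzRingType) (Q : set R) : Prop :=
  [/\ is_ideal Q, ~ Q 1
    & forall x y, Q (x * y) -> Q x \/ exists n : nat, Q (y ^+ n)].

Definition radical (R : comNzRingType) (A : set R) : set R :=
  [set x | exists n : nat, A (x ^+ n)].

Definition m_primary (R : comNzRingType) (m Q : set R) : Prop :=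
  primary_ideal Q /\ radical Q = m.

Definition noetherian (R : comNzRingType) : Prop :=
  forall A : set R, is_ideal A -> exists s : seq R, A = ideal_gen [set` s].

Definition noetherian_local (R : comNzRingType) (m : set R) : Prop :=
  [/\ noetherian R, maximal_ideal m
    & forall M : set R, maximal_ideal M -> M = m].

(* A chain of length n has n + 1 members. *)
Definition strict_chain (T : Type) (C : set (set T)) (n : nat)
    (P : nat -> set T) : Prop :=
  (forall i, (i <= n)%N -> C (P i)) /\
  (forall i, (i < n)%N -> P i `<` P i.+1).

Definition max_chain_length (T : Type) (C : set (set T)) (n : nat) : Prop :=
  (exists P, strict_chain C n P) /\
  (forall k P, strict_chain C k P -> (k <= n)%N).

Definition krull_dim (R : comNzRingType) (d : nat) : Prop :=
  max_chain_length (@prime_ideal R) d.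

(* The R-submodules of R/A are the B/A, for B an ideal containing A. *)
Definition has_length_quot (R : comNzRingType) (A : set R) (n : nat) : Prop :=
  max_chain_length [set B : set R | is_ideal B /\ A `<=` B] n.

(* Junk value 0 when R/A has infinite length. *)
Definition length_quot (R : comNzRingType) (A : set R) : nat :=
  xget 0%N (has_length_quot A).

Definition regular_sequence (R : comNzRingType) (s : seq R) : Prop :=
  ideal_gen [set` s] <> setT /\
  forall i, (i < size s)%N -> forall x : R,
    ideal_gen [set` take i s] (s`_i * x) -> ideal_gen [set` take i s] x.

Definition has_depth (R : comNzRingType) (m : set R) (n : nat) : Prop :=
  (exists s : seq R, [/\ regular_sequence s, [set` s] `<=` m & size s = n]) /\
  (forall s : seq R,
     regular_sequence s -> [set` s] `<=` m -> (size s <= n)%N).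

Definition cohen_macaulay_local (R : comNzRingType) (m : set R) : Prop :=
  noetherian_local m /\ exists n, krull_dim R n /\ has_depth m n.

Definition residue_ring (R : comNzRingType) (m : set R) : set (set R) :=
  [set [set x + y | y in m] | x in [set: R]].

Definition system_of_parameters (R : comNzRingType) (m : set R)
    (s : seq R) : Prop :=
  krull_dim R (size s) /\ m_primary m (ideal_gen [set` s]).

Definition generated_by_sop (R : comNzRingType) (m A : set R) : Prop :=
  exists s : seq R, system_of_parameters m s /\ A = ideal_gen [set` s].

(* A Laurent polynomial in t1, t2 over R is a finitely supported function
   f : int * int -> R, where f (r, s) is the coefficient of t1^r t2^s. *)
Definition laurent_mul (R : comNzRingType) (f g : int * int -> R)
    (n : int * int) : R :=
  \sum_(k \in [set: int * int]) f k * g (n - k).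

(* The direct sum of the G(r,s) t1^r t2^s, inside the Laurent polynomials. *)
Definition graded_sum (R : comNzRingType) (G : int * int -> set R) :
    set (int * int -> R) :=
  [set f | finite_set [set n | f n != 0] /\ forall n, G n (f n)].

Definition finite_module (R : comNzRingType) (A M : set (int * int -> R)) :
    Prop :=
  exists (k : nat) (g : 'I_k -> int * int -> R),
    (forall i, M (g i)) /\
    forall f, M f -> exists c : 'I_k -> int * int -> R,
      (forall i, A (c i)) /\
      forall n, f n = \sum_(i < k) laurent_mul (c i) (g i) n.

Definition product_powers (R : comNzRingType) (I J : set R) (n : int * int) :
    set R :=
  ideal_mul (ideal_expz I n.1) (ideal_expz J n.2).

Definition admissible_filtration (R : comNzRingType) (I J : set R)
    (F : int * int -> set R) : Prop :=
  (forall n, is_ideal (F n)) /\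
  [/\ forall n, product_powers I J n `<=` F n,
      forall n k, ideal_mul (F n) (F k) `<=` F (n + k),
      forall n k : int * int, n.1 <= k.1 -> n.2 <= k.2 -> F k `<=` F n,
      forall r s, F (r, s) = F (Num.max r 0, Num.max s 0)
    & finite_module (graded_sum (product_powers I J)) (graded_sum F)].

Definition hilbert_function (R : comNzRingType) (F : int * int -> set R)
    (r s : int) : nat :=
  length_quot (F (r, s)).

(* Values at r, s in nat of the polynomial with coefficients e_(a,b), the sum
   being over a + b <= d.  The truncated subtraction is harmless: at r = 0 the
   polynomial binomial(r + a - 1, a) is 1 if a = 0 and 0 otherwise, as is
   'C(r + a - 1, a). *)
Definition hilbert_poly (d : nat) (e : nat -> nat -> int) (r s : nat) : int :=
  \sum_(a < d.+1) \sum_(b < d.+1 | (a + b <= d)%N)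
    (-1) ^+ (d - (a + b)) * e a b
      * ('C(r + a - 1, a))%:Z * ('C(s + b - 1, b))%:Z.

(* This determines e a b for a + b <= d; the other values are irrelevant. *)
Definition hilbert_coefficients (R : comNzRingType) (d : nat)
    (F : int * int -> set R) (e : nat -> nat -> int) : Prop :=
  exists N : nat, forall r s : nat, (N <= r)%N -> (N <= s)%N ->
    hilbert_poly d e r s = (hilbert_function F r s)%:Z.

(* Main.v *)
Require Import Defs.
From HB Require Import structures.
From mathcomp Require Import all_boot all_order all_algebra.
From mathcomp Require Import boolp classical_sets functions cardinality fsbigop.
From mathcomp Require Import zify ring.

Set Implicit Arguments.
Unset Strict Implicit.
Unset Printing Implicit Defensive.

Import Order.TTheory GRing.Theory Num.Theory.

Local Open Scope classical_set_scope.
Local Open Scope ring_scope.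

(** Write [l(A)] for the length of [R/A], [H(r, s) = l(F(r, s))], [P] for the
    Hilbert polynomial and [e_ij] for its coefficients.  The hard implication is
    from the vanishing of the two coefficients to the equality [F = I^r J^s]; it
    rests on comparing [F(r, s)] with explicit subideals whose colength is bounded
    from above.

    Let [d = 2].  Suppose that [x, y] in [I] and [z, w] in [J] satisfy
    [l(x, y) <= e_20], [l(x, z) <= e_11], [l(w, y) <= e_11], [l(w, z) <= e_02].
    Since [F(r+1, s)] contains [x F(r, s) + (y^(r+1) z^s)], one has
    [H(r+1, s) <= H(r, s) + (r+1) e_20 + s e_11].  When [e_10 = 0] the last two
    terms are [P(r+1, s) - P(r, s)]; so the defect [D = P - H] is nondecreasing in
    [r] and, symmetrically, in [s].  It vanishes for large [r, s], hence is
    nonpositive everywhere.  On the other hand [D(0, 0) = e_00], and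
    [F(2n, 2n)] contains [u F(n, n) + v F(n, n)] with [u = x^n w^n],
    [v = y^n z^n], which gives [H(2n, 2n) <= l(u, v) + 2 H(n, n)] and, for large
    [n], [e_00 >= 0].  Therefore [D = 0], all the inclusions above are equalities,
    and [F(r, s) = I^r J^s] with [I = (x, y)], [J = (w, z)] follows by induction
    ([rigidity_two]).  For [d = 1] the same argument works with one element in
    each ideal ([rigidity_one]).

    The elements come from joint reductions: if [x F(r, s+1) + z F(r+1, s)] is
    [F(r+1, s+1)] for large [r, s], then [(x, z)] is a parameter ideal, hence
    generated by a regular sequence as [R] is Cohen-Macaulay, and counting the
    Koszul relations ([len_combine_ge]) shows that [l(x, z)] is at most the mixed
    second difference of [P], which is [e_11]; similarly for the other pairs.

    Joint reductions exist because the residue field is infinite.  A generic [x]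
    in [I] is injective on [F / m F] in large degrees
    ([generic_filter_regular], by Noetherian induction over homogeneous ideals of
    the Rees algebra, which is Noetherian by Hilbert's basis theorem).  So the
    lengths of [F / (m F + x F)] are differences of those of [F / m F], which grow
    at most linearly.  If a second generic element failed to finish the reduction
    in every degree, the lengths of [F / (m F + x F)] would grow linearly and
    those of [F / m F] quadratically ([generic_joint_reduction]).

    Conversely, a parameter ideal [I] in dimension two satisfies
    [l(I^2) = 3 l(I)], so that the values of [P = H] at [(0, 0)], [(1, 0)],
    [(2, 0)] and their mirror images force [e_00 = e_10 = e_01 = 0]. *)

(** * Ideals as sets *)

Definition idsum (R : comNzRingType) (A B : set R) : set R :=
  [set x | exists a b, [/\ A a, B b & x = a + b]].

Definition idscale (R : comNzRingType) (t : R) (A : set R) : set R :=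
  [set t * a | a in A].

Definition principal (R : comNzRingType) (t : R) : set R := idscale t setT.

Definition colon (R : comNzRingType) (B : set R) (t : R) : set R :=
  [set x | B (t * x)].

Definition pair_ideal (R : comNzRingType) (u v : R) : set R :=
  idsum (principal u) (principal v).

Section Ideals.
Variable R : comNzRingType.
Implicit Types (A B C : set R) (t u v x y a b c : R).

Lemma ideal0 A : is_ideal A -> A 0. Proof. by case. Qed.

Lemma idealD A x y : is_ideal A -> A x -> A y -> A (x + y).
Proof. by case=> _ h _; exact: h. Qed.

Lemma idealM A a x : is_ideal A -> A x -> A (a * x).
Proof. by case=> _ _; exact. Qed.

Lemma idealMr A a x : is_ideal A -> A x -> A (x * a).
Proof. by rewrite mulrC; exact: idealM. Qed.

Lemma idealN A x : is_ideal A -> A x -> A (- x).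
Proof. by move=> iA Ax; rewrite -mulN1r; exact: idealM. Qed.

Lemma idealB A x y : is_ideal A -> A x -> A y -> A (x - y).
Proof. by move=> iA Ax Ay; apply: idealD => //; exact: idealN. Qed.

Lemma ideal_sum (T : Type) (r : seq T) (P : pred T) (f : T -> R) A :
  is_ideal A -> (forall i, P i -> A (f i)) -> A (\sum_(i <- r | P i) f i).
Proof.
move=> iA h; apply: big_ind => //; first exact: ideal0.
by move=> x y; exact: idealD.
Qed.

Lemma ideal_full A : is_ideal A -> A 1 -> A = setT.
Proof.
move=> iA A1; apply/seteqP; split=> // x _.
by rewrite -[x]mulr1; exact: idealM.
Qed.

Lemma is_ideal_setT : @is_ideal R setT. Proof. by split. Qed.

Lemma is_ideal_setI A B : is_ideal A -> is_ideal B -> is_ideal (A `&` B).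
Proof.
move=> iA iB; split; first by split; exact: ideal0.
- by move=> x y [? ?] [? ?]; split; exact: idealD.
- by move=> a x [? ?]; split; exact: idealM.
Qed.

Lemma is_ideal_sum A B : is_ideal A -> is_ideal B -> is_ideal (idsum A B).
Proof.
move=> iA iB; split.
- by exists 0, 0; split; rewrite ?addr0 //; exact: ideal0.
- move=> x y [a [b [Aa Bb ->]]] [a' [b' [Aa' Bb' ->]]].
  exists (a + a'), (b + b'); split; [exact: idealD | exact: idealD |].
  by rewrite addrACA.
- move=> c x [a [b [Aa Bb ->]]]; exists (c * a), (c * b).
  by rewrite mulrDr; split=> //; exact: idealM.
Qed.

Lemma is_ideal_scale t A : is_ideal A -> is_ideal (idscale t A).
Proof.
move=> iA; split.
- by exists 0; [exact: ideal0 | rewrite mulr0].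
- move=> x y [a Aa <-] [b Ab <-]; exists (a + b); first exact: idealD.
  by rewrite mulrDr.
- move=> c x [a Aa <-]; exists (c * a); first exact: idealM.
  by rewrite mulrCA.
Qed.

Lemma is_ideal_principal t : is_ideal (principal t).
Proof. exact/is_ideal_scale/is_ideal_setT. Qed.

Lemma is_ideal_pair u v : is_ideal (pair_ideal u v).
Proof. by apply: is_ideal_sum; exact: is_ideal_principal. Qed.

Lemma is_ideal_colon B t : is_ideal B -> is_ideal (colon B t).
Proof.
move=> iB; split=> [|x y|a x]; rewrite /colon /=.
- by rewrite mulr0; exact: ideal0.
- by rewrite mulrDr; exact: idealD.
- by rewrite mulrCA; exact: idealM.
Qed.

Lemma is_ideal_gen (S : set R) : is_ideal (ideal_gen S).
Proof.
split=> [M [iM _]|x y hx hy M hM|a x hx M hM]; first exact: ideal0.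
  by apply: idealD; [case: hM | exact: hx | exact: hy].
by apply: idealM; [case: hM | exact: hx].
Qed.

Lemma sub_ideal_gen (S : set R) : S `<=` ideal_gen S.
Proof. exact: sub_gen_smallest. Qed.

Lemma ideal_gen_sub (S : set R) A : is_ideal A -> S `<=` A -> ideal_gen S `<=` A.
Proof. exact: smallest_sub. Qed.

Lemma is_ideal_mul A B : is_ideal (ideal_mul A B).
Proof. exact: is_ideal_gen. Qed.

Lemma ideal_mul_mem A B a b : A a -> B b -> ideal_mul A B (a * b).
Proof. by move=> Aa Bb; apply: sub_ideal_gen; exists a => //; exists b. Qed.

Lemma ideal_mul_sub A B C : is_ideal C -> (forall a b, A a -> B b -> C (a * b)) ->
  ideal_mul A B `<=` C.
Proof. by move=> iC h; apply: ideal_gen_sub => // x [a Aa [b Bb <-]]; exact: h. Qed.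

Lemma ideal_mulC A B : ideal_mul A B = ideal_mul B A.
Proof.
by apply/seteqP; split; apply: ideal_mul_sub;
  (try exact: is_ideal_mul); move=> a b ? ?; rewrite mulrC; exact: ideal_mul_mem.
Qed.

Lemma ideal_mul_subl A B : is_ideal A -> ideal_mul A B `<=` A.
Proof. by move=> iA; apply: ideal_mul_sub => // a b Aa _; exact: idealMr. Qed.

Lemma ideal_mul_subr A B : is_ideal B -> ideal_mul A B `<=` B.
Proof. by move=> iB; apply: ideal_mul_sub => // a b _ Bb; exact: idealM. Qed.

Lemma ideal_mulS A B A' B' : A `<=` A' -> B `<=` B' ->
  ideal_mul A B `<=` ideal_mul A' B'.
Proof.
move=> sA sB; apply: ideal_mul_sub; first exact: is_ideal_mul.
by move=> a b Aa Bb; apply: ideal_mul_mem; [exact: sA | exact: sB].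
Qed.

Lemma is_ideal_exp A n : is_ideal (ideal_exp A n).
Proof. by case: n => [|n]; [exact: is_ideal_setT | exact: is_ideal_mul]. Qed.

Lemma ideal_exp_mem A a n : A a -> ideal_exp A n (a ^+ n).
Proof.
by move=> Aa; elim: n => [|n IH] //; rewrite exprS; exact: ideal_mul_mem.
Qed.

Lemma ideal_exp_mul A n k a b :
  ideal_exp A n a -> ideal_exp A k b -> ideal_exp A (n + k) (a * b).
Proof.
move=> + kb; elim: n a => [|n IH] a.
  by move=> _; apply: idealM => //; exact: is_ideal_exp.
rewrite addSn; have : ideal_mul A (ideal_exp A n) `<=`
    colon (ideal_exp A (n + k).+1) b.
  apply: ideal_mul_sub; first exact/is_ideal_colon/is_ideal_exp.
  move=> c d Ac nd; rewrite /colon /= mulrC -mulrA.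
  by apply: ideal_mul_mem => //; exact: IH.
by move=> h /h; rewrite /colon /= mulrC.
Qed.

Lemma sub_sumL A B : is_ideal B -> A `<=` idsum A B.
Proof. by move=> iB x Ax; exists x, 0; rewrite addr0; split=> //; exact: ideal0. Qed.

Lemma sub_sumR A B : is_ideal A -> B `<=` idsum A B.
Proof. by move=> iA x Bx; exists 0, x; rewrite add0r; split=> //; exact: ideal0. Qed.

Lemma sum_sub A B C : is_ideal C -> A `<=` C -> B `<=` C -> idsum A B `<=` C.
Proof.
by move=> iC sA sB x [a [b [Aa Bb ->]]]; apply: idealD => //; [exact: sA | exact: sB].
Qed.

Lemma sumS A B A' B' : A `<=` A' -> B `<=` B' -> idsum A B `<=` idsum A' B'.
Proof.
move=> sA sB x [a [b [Aa Bb ->]]]; exists a, b.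
by split=> //; [exact: sA | exact: sB].
Qed.

Lemma idsumC A B : idsum A B = idsum B A.
Proof.
by apply/seteqP; split=> x [a [b [? ? ->]]]; exists b, a; rewrite addrC.
Qed.

Lemma scale_sub t A C : (forall a, A a -> C (t * a)) -> idscale t A `<=` C.
Proof. by move=> h x [a Aa <-]; exact: h. Qed.

Lemma principal_sub t C : is_ideal C -> C t -> principal t `<=` C.
Proof. by move=> iC Ct; apply: scale_sub => a _; exact: idealMr. Qed.

Lemma principal_mem t a : principal t (t * a).
Proof. by exists a. Qed.

Lemma principal_id t : principal t t.
Proof. by exists 1 => //; rewrite mulr1. Qed.

Lemma pair_ideal_sub u v C : is_ideal C -> C u -> C v -> pair_ideal u v `<=` C.
Proof. by move=> iC Cu Cv; apply: sum_sub => //; exact: principal_sub. Qed.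

Lemma pair_idealL u v : pair_ideal u v u.
Proof. by apply: (sub_sumL (is_ideal_principal v)); exact: principal_id. Qed.

Lemma pair_idealR u v : pair_ideal u v v.
Proof. by apply: (sub_sumR (is_ideal_principal u)); exact: principal_id. Qed.

Lemma pair_idealC u v : pair_ideal u v = pair_ideal v u.
Proof. exact: idsumC. Qed.

Lemma ideal_gen_nil : ideal_gen [set` [::] : seq R] = [set 0].
Proof.
apply/seteqP; split.
  apply: ideal_gen_sub => //; split=> [//|x y /= -> ->|a x /= ->].
    by rewrite addr0.
  by rewrite mulr0.
by move=> x ->; apply: ideal0; exact: is_ideal_gen.
Qed.

Lemma ideal_gen_cons (a : R) s :
  ideal_gen [set` a :: s] = idsum (principal a) (ideal_gen [set` s]).
Proof.
have is_ := is_ideal_gen [set` s]; have ia := is_ideal_principal a.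
apply/seteqP; split.
  apply: ideal_gen_sub; first exact: is_ideal_sum.
  move=> x /=; rewrite inE => /orP[/eqP ->|xs].
    by apply: (sub_sumL is_); exact: principal_id.
  by apply: (sub_sumR ia); exact: sub_ideal_gen.
apply: sum_sub; first exact: is_ideal_gen.
  apply: principal_sub; first exact: is_ideal_gen.
  by apply: sub_ideal_gen; rewrite /= inE eqxx.
apply: ideal_gen_sub; first exact: is_ideal_gen.
by move=> x xs; apply: sub_ideal_gen; rewrite /= inE; apply/orP; right.
Qed.

Lemma ideal_gen1 (x : R) : ideal_gen [set` [:: x]] = principal x.
Proof.
rewrite ideal_gen_cons ideal_gen_nil; apply/seteqP; split.
  apply: sum_sub => //; first exact: is_ideal_principal.
  by move=> _ ->; apply: ideal0; exact: is_ideal_principal.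
by move=> y hy; exists y, 0; rewrite addr0.
Qed.

Lemma ideal_gen2 (x y : R) : ideal_gen [set` [:: x; y]] = pair_ideal x y.
Proof. by rewrite ideal_gen_cons ideal_gen1. Qed.

End Ideals.

(** * Noetherian induction and local rings *)

(** Well-founded induction along an ascending chain condition: a failure of [P]
    would propagate to larger and larger elements. *)
Lemma chain_ind (T : Type) (gt : T -> T -> Prop) (P : T -> Prop) :
  (forall f : nat -> T, ~ forall n, gt (f n) (f n.+1)) ->
  (forall x, (forall y, gt x y -> P y) -> P x) -> forall x, P x.
Proof.
move=> acc step x; apply: contrapT => Px.
have next (u : {x | ~ P x}) : {v : {x | ~ P x} | gt (sval u) (sval v)}.
  case: u => u Pu /=; apply: cid.
  have [y [guy Py]] : exists y, gt u y /\ ~ P y.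
    apply: contrapT => h; apply: Pu; apply: step => y guy.
    by apply: contrapT => Py; apply: h; exists y.
  by exists (exist _ y Py).
pose f n := iter n (fun u => sval (next u)) (exist _ x Px).
by apply: (acc (fun n => sval (f n))) => n; exact: svalP (next (f n)).
Qed.

Lemma nondec_chain (T : Type) (N : nat -> set T) :
  (forall n, N n `<=` N n.+1) -> forall i j, (i <= j)%N -> N i `<=` N j.
Proof.
move=> mN i j; elim: j => [|j IH]; first by rewrite leqn0 => /eqP ->.
rewrite leq_eqVlt => /orP[/eqP -> //|ij].
by apply: subset_trans (mN j); exact: IH.
Qed.

Section Noetherian.
Variable R : comNzRingType.
Hypothesis nR : noetherian R.
Implicit Types (A B C : set R) (x y a b c : R).

Lemma noetherian_chain (N : nat -> set R) :
  (forall n, is_ideal (N n)) -> (forall n, N n `<=` N n.+1) ->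
  exists n, forall k, (n <= k)%N -> N k `<=` N n.
Proof.
move=> iN mN; have mono := nondec_chain mN.
pose U := [set x | exists n, N n x].
have iU : is_ideal U.
  split; first by exists 0%N; exact: ideal0.
  - move=> x y [i Nx] [j Ny]; exists (maxn i j); apply: idealD => //.
      exact: mono (leq_maxl i j) _ Nx.
    exact: mono (leq_maxr i j) _ Ny.
  - by move=> a x [i Nx]; exists i; exact: idealM.
have [s Us] := nR iU.
have [n hn] : exists n, [set` s] `<=` N n.
  have : forall x, x \in s -> U x.
    by move=> x xs; rewrite Us; exact: sub_ideal_gen.
  elim: s {Us} => [|a s IH] h; first by exists 0%N.
  have [i Ni] := h a (mem_head a s).
  have [x xs|j hj] := IH; first by apply: h; rewrite inE xs orbT.
  exists (maxn i j) => x /=; rewrite inE => /orP[/eqP ->|xs].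
    exact: mono (leq_maxl i j) _ Ni.
  exact: mono (leq_maxr i j) _ (hj _ xs).
exists n => k _ x Nx; have : U x by exists k.
by rewrite Us; exact: ideal_gen_sub.
Qed.

Lemma ideal_ind (P : set R -> Prop) :
  (forall A, is_ideal A -> (forall B, is_ideal B -> A `<` B -> P B) -> P A) ->
  forall A, is_ideal A -> P A.
Proof.
move=> step; apply: (chain_ind
  (gt := fun A B => [/\ is_ideal A, is_ideal B & A `<` B])).
  move=> f h; have [n hn] := noetherian_chain (fun n => let: And3 i _ _ := h n in i)
    (fun n => let: And3 _ _ (conj i _) := h n in i).
  by have [_ _ [_]] := h n; apply; exact: hn.
by move=> A IH iA; apply: step => // B iB AB; exact: IH.
Qed.

Lemma maximal_member (T : Type) (D : set T) (B : T -> set R) :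
  (forall t, D t -> is_ideal (B t)) -> (exists t, D t) ->
  exists2 t, D t & forall u, D u -> B t `<=` B u -> B u `<=` B t.
Proof.
move=> iB [t0 Dt0]; apply: contrapT => no.
suff h A : is_ideal A -> forall t, D t -> A = B t -> False.
  exact: h (iB _ Dt0) _ Dt0 erefl.
move: A; apply: ideal_ind => A iA IH t Dt At; apply: no; exists t => // u Du tu.
apply: contrapT => ut; apply: (IH (B u)) => //; first exact: iB.
  by split; rewrite At.
exact: Du.
Qed.

Variable m : set R.
Hypothesis mm : maximal_ideal m.
Hypothesis mloc : forall M : set R, maximal_ideal M -> M = m.

Lemma max_is_ideal : is_ideal m. Proof. by case: mm. Qed.

Lemma max_proper : ~ m 1.
Proof. by case: mm => im ne _ /(ideal_full im). Qed.

Lemma proper_sub_max A : is_ideal A -> ~ A 1 -> A `<=` m.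
Proof.
move: A; apply: ideal_ind => A iA IH A1.
have [maxA|nmax] := pselect (maximal_ideal A); first by rewrite (mloc maxA).
have [B [iB AB B1]] : exists B, [/\ is_ideal B, A `<` B & ~ B 1].
  apply: contrapT => no; apply: nmax; split=> //; first by move=> E; apply: A1; rewrite E.
  move=> B iB AB; have [BA|BA] := pselect (B `<=` A).
    by left; apply/seteqP.
  right; apply: ideal_full => //; apply: contrapT => B1.
  by apply: no; exists B.
by apply: subset_trans (IH B iB AB B1); case: AB.
Qed.

Lemma unit_outside_max x : ~ m x -> exists y, x * y = 1.
Proof.
move=> mx; apply: contrapT => no; apply: mx.
apply: (proper_sub_max (is_ideal_principal x)); last exact: principal_id.
by case=> y _ h; apply: no; exists y.
Qed.

Lemma one_sub_max_unit c : m c -> exists y, (1 - c) * y = 1.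
Proof.
move=> mc; apply: unit_outside_max => m1; apply: max_proper.
by rewrite -(subrK c 1); apply: idealD => //; exact: max_is_ideal.
Qed.

(** If [(1 - c) a] lies in an ideal and [c] is in the maximal ideal, so does [a]:
    the last step of every Nakayama-type argument below. *)
Lemma absorb A a b c : is_ideal A -> m c -> A b -> a = b + c * a -> A a.
Proof.
move=> iA mc Ab E; have [y hy] := one_sub_max_unit mc.
have -> : a = y * b.
  have -> : b = (1 - c) * a by rewrite mulrBl mul1r {1}E addrK.
  by rewrite mulrA (mulrC y) hy mul1r.
exact: idealM.
Qed.

(** Induction on the number of generators of [A]: modulo the first one the claim
    holds for the others, and [absorb] then removes the first one. *)
Lemma nakayama A B : is_ideal A -> is_ideal B ->
  A `<=` idsum B (ideal_mul m A) -> A `<=` B.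
Proof.
move=> iA iB; have [s ->] := nR iA => {A iA}.
have key C (t : seq R) : is_ideal C ->
    (forall x, x \in t -> idsum C (ideal_mul m (ideal_gen [set` t])) x) ->
    forall x, x \in t -> C x.
  elim: t C => [|a t IH] C iC h x //.
  pose D := idsum C (principal a).
  have iD : is_ideal D by apply: is_ideal_sum => //; exact: is_ideal_principal.
  have mG : ideal_mul m (ideal_gen [set` a :: t]) `<=`
      idsum (idscale a m) (ideal_mul m (ideal_gen [set` t])).
    rewrite ideal_gen_cons; apply: ideal_mul_sub.
      apply: is_ideal_sum; last exact: is_ideal_mul.
      by apply: is_ideal_scale; exact: max_is_ideal.
    move=> u _ mu [_ [g [[c _ <-] tg ->]]]; exists (a * (u * c)), (u * g); split.
    - by exists (u * c) => //; apply: idealMr => //; exact: max_is_ideal.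
    - exact: ideal_mul_mem.
    - by ring.
  have tD y : y \in t -> D y.
    apply: (IH D iD) => z zt.
    have [b [_ [Cb /mG [_ [g [[u mu <-] tg ->]]] ->]]] :=
      h z (mem_behead (s := a :: t) zt).
    exists (b + a * u), g; split=> //; last by rewrite addrA.
    by exists b, (a * u); split=> //; exact: principal_mem.
  have aC : C a.
    have [b [_ [Cb /mG [_ [g [[u mu <-] tg ->]]] E]]] := h a (mem_head a t).
    have : idsum C (idscale a m) g.
      apply: (ideal_mul_sub _ _ tg).
        by apply: is_ideal_sum => //; apply: is_ideal_scale; exact: max_is_ideal.
      move=> v y mv ty; have : D y.
        by apply: (ideal_gen_sub iD _ ty) => z; exact: tD.
      case=> c [_ [Cc [w _ <-] ->]]; exists (v * c), (a * (v * w)).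
      split; [exact: idealM | | by ring].
      by exists (v * w) => //; apply: idealMr => //; exact: max_is_ideal.
    case=> c [_ [Cc [w mw <-] Eg]].
    apply: (@absorb C a (b + c) (u + w)) => //; first by apply: idealD => //; exact: max_is_ideal.
      exact: idealD.
    by rewrite {1}E Eg; ring.
  rewrite inE => /orP[/eqP -> //|/tD]; case=> b [_ [Cb [w _ <-] ->]].
  by apply: idealD => //; exact: idealMr.
move=> h; apply: ideal_gen_sub => // x xs.
by apply: (key B s iB _ x xs) => y ys; apply: h; exact: sub_ideal_gen.
Qed.

(** Krull's intersection theorem for a principal ideal. If [a = y^k b_k] for all
    [k], some [b_n] is a combination of the earlier ones, and multiplying by
    [y^n] expresses [a] as a multiple of [y a]. *)
Lemma krull_intersection_principal y a : m y ->
  (forall k, exists b, a = y ^+ k * b) -> a = 0.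
Proof.
move=> my h; pose b k := sval (cid (h k)).
have ab k : a = y ^+ k * b k by exact: svalP (cid (h k)).
pose N n := ideal_gen [set b i | i in [set i | (i < n)%N]].
have mN n : N n `<=` N n.+1.
  apply: ideal_gen_sub; first exact: is_ideal_gen.
  move=> _ [i /= lin <-]; apply: sub_ideal_gen; exists i => //=.
  by rewrite ltnW.
have [n hn] := noetherian_chain (fun n => is_ideal_gen _) mN.
have : N n (b n).
  by apply: (hn n.+1) => //; apply: sub_ideal_gen; exists n => //=.
have : N n `<=` [set x | principal (y * a) (y ^+ n * x)].
  apply: ideal_gen_sub; first exact/is_ideal_colon/is_ideal_principal.
  move=> _ [i /= lin <-].
  have -> : y ^+ n * b i = y * a * y ^+ (n - i.+1).
    by rewrite {1}(ab i) -{1}(subnKC lin) exprD exprS; ring.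
  exact: principal_mem.
move=> /[apply] /=; rewrite -ab => -[c _ E].
have i0 : @is_ideal R [set 0].
  by split=> [//|x z /= -> ->|d x /= ->]; rewrite ?addr0 ?mulr0.
apply: (@absorb _ a 0 (y * c) i0) => //.
  by apply: idealMr => //; exact: max_is_ideal.
by rewrite -{1}E; ring.
Qed.

End Noetherian.
(** * Lengths of quotients by ideals *)

Definition interval (R : comNzRingType) (A B : set R) : set (set R) :=
  [set X | [/\ is_ideal X, A `<=` X & X `<=` B]].

Definition finite_length (R : comNzRingType) (A : set R) : Prop :=
  exists n, has_length_quot A n.

Section ChainLength.
Variable T : Type.
Implicit Types C : set (set T).

Lemma max_chain_uniq C n k :
  max_chain_length C n -> max_chain_length C k -> n = k.
Proof.
by move=> [[P hP] hn] [[Q hQ] hk]; apply/eqP; rewrite eqn_leq (hk _ P) // (hn _ Q).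
Qed.

Lemma max_chain_exists C b : (exists X, C X) ->
  (forall k P, strict_chain C k P -> (k <= b)%N) ->
  exists2 n, (n <= b)%N & max_chain_length C n.
Proof.
move=> [X CX] hb; pose p k := `[< exists P, strict_chain C k P >].
have p0 : exists k, p k by exists 0%N; apply/asboolP; exists (fun=> X).
have pb k : p k -> (k <= b)%N by move=> /asboolP[P]; exact: hb.
case: (ex_maxnP p0 pb) => n pn nmax; exists n; first exact: pb.
by split=> [|k P hP]; [exact/asboolP | apply: nmax; apply/asboolP; exists P].
Qed.

Lemma strict_chain_map (U : Type) C (C' : set (set U)) f k P :
  (forall X, C X -> C' (f X)) ->
  (forall X Y, C X -> C Y -> X `<` Y -> f X `<` f Y) ->
  strict_chain C k P -> strict_chain C' k (f \o P).
Proof.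
move=> hf sf [CP sP]; split=> i ik /=; first by apply: hf; exact: CP.
by apply: sf; [apply: CP; exact: ltnW | exact: CP | exact: sP].
Qed.

End ChainLength.

Section Length.
Variable R : comNzRingType.
Implicit Types (A B C D K L : set R) (t u v x y z a b c : R).
Local Notation len := (@length_quot R).

Lemma interval_cat A B D i j P Q : A `<=` B -> B `<=` D ->
  strict_chain (interval A B) i P -> strict_chain (interval B D) j Q ->
  exists X, strict_chain (interval A D) (i + j) X.
Proof.
move=> AB BD [CP sP] [CQ sQ].
exists (fun k => if (k < i)%N then P k else Q (k - i)%N); split=> k kij.
  case: ltnP => ki.
    have [iP AP PB] := CP k (ltnW ki).
    by split=> //; exact: subset_trans BD.
  have [|iQ BQ QD] := CQ (k - i)%N; first by rewrite leq_subLR.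
  by split=> //; exact: subset_trans BQ.
case: ltnP => ki; case: ltnP => ki1.
- exact: sP.
- have ei : k.+1 = i by apply/eqP; rewrite eqn_leq ki ki1.
  have [_ _ PB] := CP i (leqnn i); have := sP k ki; rewrite ei subnn.
  have [_ BQ _] := CQ 0%N (leq0n j) => -[PP nPP].
  split; first by apply: subset_trans PP _; exact: subset_trans BQ.
  by move=> QP; apply: nPP; apply: subset_trans PB _; exact: subset_trans QP.
- by lia.
- by rewrite subSn //; apply: sQ; lia.
Qed.

(** By the modular law, each strict step [X < Y] remains strict after
    intersecting with [B] or after adding [B]. *)
Lemma interval_split A B D k X : is_ideal B -> A `<=` B -> B `<=` D -> is_ideal D ->
  strict_chain (interval A D) k X ->
  exists i j P Q, [/\ (k <= i + j)%N,
    strict_chain (interval A B) i P, P i = X k `&` B,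
    strict_chain (interval B D) j Q & Q j = idsum (X k) B].
Proof.
move=> iB AB BD iD; elim: k => [|k IH] [CX sX].
  have [iX AX XD] := CX 0%N isT.
  exists 0%N, 0%N, (fun=> X 0%N `&` B), (fun=> idsum (X 0%N) B); split=> //.
    split=> // _ _; split; first exact: is_ideal_setI.
      by move=> x Ax; split; [exact: AX | exact: AB].
    by move=> x [].
  split=> // _ _; split; first exact: is_ideal_sum.
    exact: sub_sumR.
  exact: sum_sub.
have [|i [j [P [Q [kij [CP sP] EP [CQ sQ] EQ]]]]] := IH.
  by split=> l lk; [apply: CX; exact: leqW | apply: sX; exact: leqW].
have [iX AX XD] := CX k (leqnSn k); have [iY AY YD] := CX k.+1 (leqnn _).
have [XY YX] := sX k (leqnn _).
have inI : interval A B (X k.+1 `&` B).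
  split; [exact: is_ideal_setI | | by move=> x []].
  by move=> x Ax; split; [exact: AY | exact: AB].
have inS : interval B D (idsum (X k.+1) B).
  by split; [exact: is_ideal_sum | exact: sub_sumR | exact: sum_sub].
have subI : X k `&` B `<=` X k.+1 `&` B by move=> x [? ?]; split=> //; exact: XY.
have subS : idsum (X k) B `<=` idsum (X k.+1) B by apply: sumS.
have extend (C : set (set R)) n (S : nat -> set R) Y : strict_chain C n S -> C Y -> S n `<` Y ->
    strict_chain C n.+1 (fun l => if (l <= n)%N then S l else Y).
  move=> [CS sS] CY SY; split=> l ln; first by case: leqP => // ?; exact: CS.
  have ln' : (l <= n)%N := ln; rewrite ln'; case: ltnP => h; first exact: sS.
  by have -> : l = n by lia.
have [hI|hI] := pselect (X k.+1 `&` B `<=` X k `&` B); last first.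
  exists i.+1, j, (fun l => if (l <= i)%N then P l else X k.+1 `&` B).
  exists (fun l => if (l < j)%N then Q l else idsum (X k.+1) B).
  rewrite !ltnn; split=> //.
    by apply: extend => //; rewrite EP; split.
  split=> l lj; first by case: ltnP => // ?; exact: CQ.
  rewrite lj; case: ltnP => h; first exact: sQ.
  have el : l.+1 = j by lia.
  have := sQ l lj; rewrite el EQ => -[s1 s2]; split.
    exact: subset_trans subS.
  by move=> h'; apply: s2; exact: subset_trans h'.
exists i, j.+1, (fun l => if (l < i)%N then P l else X k.+1 `&` B).
exists (fun l => if (l <= j)%N then Q l else idsum (X k.+1) B).
rewrite !ltnn; split=> //; first by lia.
  split=> l li; first by case: ltnP => // ?; exact: CP.
  rewrite li; case: ltnP => h; first exact: sP.
  have el : l.+1 = i by lia.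
  have := sP l li; rewrite el EP => -[s1 s2]; split.
    exact: subset_trans subI.
  by move=> h'; apply: s2; exact: subset_trans h'.
apply: extend => //; rewrite EQ; split=> // hS; apply: YX => y Yy.
have [a [b [Xa Bb E]]] : idsum (X k) B y by apply: hS; exact: sub_sumL.
rewrite E; apply: idealD => //.
have [] // : (X k `&` B) b; apply: hI; split=> //.
by rewrite -(addrK a b) addrC addrA -addrA [b + a]addrC -E addrC; apply: idealB => //; exact: XY.
Qed.

Lemma interval_add A B D i j : is_ideal B -> is_ideal D -> A `<=` B -> B `<=` D ->
  max_chain_length (interval A B) i -> max_chain_length (interval B D) j ->
  max_chain_length (interval A D) (i + j).
Proof.
move=> iB iD AB BD [[P hP] mi] [[Q hQ] mj]; split.
  exact: interval_cat hP hQ.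
move=> k X /(interval_split iB AB BD iD)[i' [j' [P' [Q' [k_le hP' _ hQ' _]]]]].
by apply: leq_trans k_le _; apply: leq_add; [exact: mi hP' | exact: mj hQ'].
Qed.

Lemma has_length_interval A n :
  has_length_quot A n = max_chain_length (interval A setT) n.
Proof.
rewrite /has_length_quot; congr (max_chain_length _ n).
by apply/seteqP; split=> X; [case=> ? ?; split | case].
Qed.

Lemma lenE A n : has_length_quot A n -> len A = n.
Proof. by move=> h; apply: xget_unique => // k hk; exact: max_chain_uniq hk h. Qed.

Lemma len_interval A B : is_ideal A -> is_ideal B -> A `<=` B -> finite_length A ->
  finite_length B /\
  exists2 n, max_chain_length (interval A B) n & len A = (len B + n)%N.
Proof.
move=> iA iB AB [a ha]; have := ha; rewrite has_length_interval => -[_ ma].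
have iT : is_ideal (@setT R) by exact: is_ideal_setT.
have bound (C : set (set R)) : (forall X, C X -> interval A setT X) ->
    forall k P, strict_chain C k P -> (k <= a)%N.
  by move=> sC k P [CP sP]; apply: (ma k P); split=> // l lk; exact/sC/CP.
have [||i _ hi] := @max_chain_exists _ (interval A B) a.
- by exists A; split.
- by apply: bound => X [].
have [||j _ hj] := @max_chain_exists _ (interval B setT) a.
- by exists B; split.
- by apply: bound => X [iX BX _]; split=> //; exact: subset_trans BX.
have hB : has_length_quot B j by rewrite has_length_interval.
split; first by exists j.
exists i => //; rewrite (lenE hB) addnC.
by apply: lenE; rewrite has_length_interval; exact: interval_add hi hj.
Qed.

Lemma finite_length_sub A B : is_ideal A -> is_ideal B -> A `<=` B ->
  finite_length A -> finite_length B.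
Proof. by move=> iA iB AB /(len_interval iA iB AB)[]. Qed.

Lemma len_sub A B : is_ideal A -> is_ideal B -> A `<=` B -> finite_length A ->
  (len B <= len A)%N.
Proof. by move=> iA iB AB /(len_interval iA iB AB)[_ [n _ ->]]; exact: leq_addr. Qed.

Lemma len_lt A B : is_ideal A -> is_ideal B -> A `<` B -> finite_length A ->
  (len B < len A)%N.
Proof.
move=> iA iB [AB nBA] /(len_interval iA iB AB)[_ [n [_ mn] ->]].
rewrite -[X in (X < _)%N]addn0 ltn_add2l.
apply: (mn 1%N (fun i => if i is 0%N then A else B)); split=> [i _|[|i] // _].
by case: i => [|i]; split.
Qed.

Lemma len_eq A B : is_ideal A -> is_ideal B -> A `<=` B -> finite_length A ->
  (len A <= len B)%N -> A = B.
Proof.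
move=> iA iB AB fA h; apply/seteqP; split=> //; apply: contrapT => BA.
by have := len_lt iA iB (conj AB BA) fA; rewrite ltnNge h.
Qed.

Lemma has_length_setT : has_length_quot (@setT R) 0%N.
Proof.
split; first by exists (fun=> setT); split=> // i _; split=> //; exact: is_ideal_setT.
case=> [//|k] P [CP sP]; have [_ h1] := CP 0%N isT; have [_] := sP 0%N isT.
by case; exact: subset_trans h1.
Qed.

Lemma finite_length_setT : finite_length (@setT R).
Proof. by exists 0%N; exact: has_length_setT. Qed.

Lemma len_setT : len setT = 0%N.
Proof. exact/lenE/has_length_setT. Qed.

(** Multiplication by [t] identifies [A / (A n (B : t))] with [(t A + B) / B];
    on ideals it is given by the two maps of the next lemmas. *)
Lemma colon_strict A B t X Y : is_ideal A -> is_ideal B ->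
  interval B (idsum (idscale t A) B) X -> interval B (idsum (idscale t A) B) Y ->
  X `<` Y -> A `&` colon X t `<` A `&` colon Y t.
Proof.
move=> iA iB [iX BX XC] [iY BY YC] [XY nYX].
split; first by move=> x [Ax Xx]; split=> //; exact: XY.
move=> h; apply: nYX => y Yy; have [_ [b [[a Aa <-] Bb E]]] := YC y Yy.
rewrite E; apply: idealD => //; last exact: BX.
have [] // : (A `&` colon X t) a; apply: h; split=> //; rewrite /colon /=.
by rewrite -(addrK b (t * a)) -E; apply: idealB => //; exact: BY.
Qed.

Lemma scale_strict A B t X Y : is_ideal A -> is_ideal B ->
  interval (A `&` colon B t) A X -> interval (A `&` colon B t) A Y ->
  X `<` Y -> idsum (idscale t X) B `<` idsum (idscale t Y) B.
Proof.
move=> iA iB [iX DX XA] [iY DY YA] [XY nYX].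
have sXY : idscale t X `<=` idscale t Y.
  by move=> _ [x Xx <-]; exists x => //; exact: XY.
split; first exact: sumS.
move=> h; apply: nYX => y Yy.
have [_ [b [[x Xx <-] Bb E]]] : idsum (idscale t X) B (t * y).
  by apply: h; apply: sub_sumL => //; exists y.
rewrite -(subrK x y); apply: idealD => //; apply: DX; split.
  by apply: idealB => //; [exact: YA | exact: XA].
by rewrite /colon /= mulrBr E addrC addKr.
Qed.

Lemma interval_scale A B t n : is_ideal A -> is_ideal B ->
  max_chain_length (interval B (idsum (idscale t A) B)) n <->
  max_chain_length (interval (A `&` colon B t) A) n.
Proof.
move=> iA iB; set C := idsum _ _; set D := A `&` _.
have hf X : interval B C X -> interval D A (A `&` colon X t).
  move=> [iX BX XC]; split; last by move=> x [].
    by apply: is_ideal_setI => //; exact: is_ideal_colon.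
  by move=> x [Ax Bx]; split=> //; exact: BX.
have hg X : interval D A X -> interval B C (idsum (idscale t X) B).
  move=> [iX DX XA]; split; first by apply: is_ideal_sum => //; exact: is_ideal_scale.
    by apply: sub_sumR; exact: is_ideal_scale.
  by apply: sumS => // _ [x Xx <-]; exists x => //; exact: XA.
have sf X Y := @colon_strict A B t X Y iA iB.
have sg X Y := @scale_strict A B t X Y iA iB.
split=> -[[P hP] mn]; split.
- by exists ((fun X => A `&` colon X t) \o P); exact: strict_chain_map hP.
- by move=> k Q hQ; apply: mn (strict_chain_map hg sg hQ).
- by exists ((fun X => idsum (idscale t X) B) \o P); exact: strict_chain_map hP.
- by move=> k Q hQ; apply: mn (strict_chain_map hf sf hQ).
Qed.

Lemma finite_length_add A B n : is_ideal A -> is_ideal B -> A `<=` B ->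
  finite_length B -> max_chain_length (interval A B) n ->
  finite_length A /\ len A = (len B + n)%N.
Proof.
move=> iA iB AB [b hb] hn.
have hA : has_length_quot A (n + b).
  rewrite has_length_interval; apply: interval_add hn _ => //.
  by rewrite -has_length_interval.
by split; [exists (n + b)%N | rewrite (lenE hA) (lenE hb) addnC].
Qed.

(** Additivity of length along [B <= t A + B] and [A n (B : t) <= A], the two
    intervals being isomorphic by multiplication by [t]. *)
Lemma len_scale A B t : is_ideal A -> is_ideal B ->
  finite_length A -> finite_length B ->
  (len B + len A =
     len (idsum (idscale t A) B) + len (A `&` colon B t))%N.
Proof.
move=> iA iB fA fB; set C := idsum _ _; set D := A `&` _.
have iC : is_ideal C by apply: is_ideal_sum => //; exact: is_ideal_scale.
have iD : is_ideal D by apply: is_ideal_setI => //; exact: is_ideal_colon.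
have BC : B `<=` C by apply: sub_sumR; exact: is_ideal_scale.
have DA : D `<=` A by move=> x [].
have [fC [n hn ->]] := len_interval iB iC BC fB.
have [_ ->] := finite_length_add iD iA DA fA (proj1 (interval_scale t n iA iB) hn).
by lia.
Qed.

Lemma finite_length_colon B t : is_ideal B -> finite_length B ->
  finite_length (colon B t).
Proof.
move=> iB; apply: finite_length_sub => //; first exact: is_ideal_colon.
by move=> x Bx; exact: idealM.
Qed.

(** [R/B] is an extension of [R/(t R + B)] by [R/(B : t)]. *)
Lemma len_cover A A' B t : is_ideal A -> is_ideal A' -> is_ideal B ->
  A `<=` colon B t -> A' `<=` idsum (principal t) B ->
  finite_length A -> finite_length A' ->
  finite_length B /\ (len B <= len A + len A')%N.
Proof.
move=> iA iA' iB AB A'B fA fA'.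
have iT := @is_ideal_setT R.
have iD : is_ideal (setT `&` colon B t).
  by apply: is_ideal_setI => //; exact: is_ideal_colon.
have iC : is_ideal (idsum (principal t) B).
  by apply: is_ideal_sum => //; exact: is_ideal_principal.
have AD : A `<=` setT `&` colon B t by move=> x /AB.
have fD := finite_length_sub iA iD AD fA.
have fC := finite_length_sub iA' iC A'B fA'.
have [_ [n hn En]] := len_interval iD iT (fun x h => proj1 h) fD.
have BC : B `<=` idsum (principal t) B.
  by apply: sub_sumR; exact: is_ideal_principal.
have [fB EB] := finite_length_add iB iC BC fC (proj2 (interval_scale t n iT iB) hn).
split=> //; rewrite EB addnC; apply: leq_add; last exact: len_sub fA'.
by have := len_sub iA iD AD fA; rewrite En len_setT.
Qed.

Lemma len_principal_split B t : is_ideal B -> finite_length B ->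
  len B = (len (idsum (principal t) B) + len (colon B t))%N.
Proof.
move=> iB fB; have := len_scale t (@is_ideal_setT R) iB finite_length_setT fB.
by rewrite len_setT addn0 setTI.
Qed.

Lemma len_pair_mul u v b :
  finite_length (pair_ideal u b) -> finite_length (pair_ideal v b) ->
  finite_length (pair_ideal (u * v) b) /\
  (len (pair_ideal (u * v) b) <= len (pair_ideal u b) + len (pair_ideal v b))%N.
Proof.
move=> fu fv; have iB := is_ideal_pair (u * v) b.
have iC : is_ideal (idsum (principal u) (pair_ideal (u * v) b)).
  by apply: is_ideal_sum => //; exact: is_ideal_principal.
rewrite addnC; apply: (@len_cover _ _ _ u) => //; try exact: is_ideal_pair.
- apply: pair_ideal_sub; first exact: is_ideal_colon.
    exact: pair_idealL.
  by rewrite /colon /=; apply: idealM => //; exact: pair_idealR.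
- apply: pair_ideal_sub => //.
    by apply: sub_sumL => //; exact: principal_id.
  by apply: sub_sumR; [exact: is_ideal_principal | exact: pair_idealR].
Qed.

Lemma len_pair_exp u b n : finite_length (pair_ideal u b) ->
  finite_length (pair_ideal (u ^+ n) b) /\
  (len (pair_ideal (u ^+ n) b) <= n * len (pair_ideal u b))%N.
Proof.
move=> fu; elim: n => [|n [fn ln]].
  rewrite expr0; have -> : pair_ideal 1 b = setT.
    by apply: ideal_full; [exact: is_ideal_pair | exact: pair_idealL].
  by rewrite len_setT; split=> //; exact: finite_length_setT.
rewrite exprS mulSn; have [fm lm] := len_pair_mul fu fn.
by split=> //; apply: leq_trans lm _; rewrite leq_add2l.
Qed.

Lemma len_pair_monomial u v b i j :
  finite_length (pair_ideal u b) -> finite_length (pair_ideal v b) ->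
  finite_length (pair_ideal (u ^+ i * v ^+ j) b) /\
  (len (pair_ideal (u ^+ i * v ^+ j) b) <=
     i * len (pair_ideal u b) + j * len (pair_ideal v b))%N.
Proof.
move=> /(len_pair_exp i)[fu lu] /(len_pair_exp j)[fv lv].
have [fm lm] := len_pair_mul fu fv.
by split=> //; apply: leq_trans lm _; exact: leq_add.
Qed.

Lemma is_ideal_combine x z K L : is_ideal K -> is_ideal L ->
  is_ideal (idsum (idscale x K) (idscale z L)).
Proof. by move=> iK iL; apply: is_ideal_sum; exact: is_ideal_scale. Qed.

Lemma len_combine_le x z K L : is_ideal K -> is_ideal L ->
  finite_length (pair_ideal x z) -> finite_length K -> finite_length L ->
  finite_length (idsum (idscale x K) (idscale z L)) /\
  (len (idsum (idscale x K) (idscale z L)) <=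
     len (pair_ideal x z) + len K + len L)%N.
Proof.
move=> iK iL fxz fK fL.
have iB : is_ideal (idsum (principal x) (idscale z L)).
  by apply: is_ideal_sum; [exact: is_ideal_principal | exact: is_ideal_scale].
have ip := is_ideal_principal; have isc := @is_ideal_scale R.
have [fB lB] : finite_length (idsum (principal x) (idscale z L)) /\
    (len (idsum (principal x) (idscale z L)) <= len L + len (pair_ideal x z))%N.
  apply: (@len_cover _ _ _ z) => //; first exact: is_ideal_pair.
    by move=> a La; apply: sub_sumR => //; exists a.
  apply: pair_ideal_sub; first exact: is_ideal_sum.
    apply: sub_sumR => //; apply: sub_sumL; [exact: isc | exact: principal_id].
  by apply: sub_sumL => //; exact: principal_id.
have [fA lA] : finite_length (idsum (idscale x K) (idscale z L)) /\
    (len (idsum (idscale x K) (idscale z L)) <=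
       len K + len (idsum (principal x) (idscale z L)))%N.
  apply: (@len_cover _ _ _ x) => //; first exact: is_ideal_combine.
    by move=> a Ka; apply: sub_sumL; [exact: isc | exists a].
  apply: sumS => //; apply: sub_sumR; exact: isc.
by split=> //; lia.
Qed.

(** For a regular sequence [x, z] the kernel of [K + L -> x K + z L] consists of
    the Koszul relations [(z u, - x u)], with [u] in [(K : z) n (L : x)]; hence
    the previous inequality is an equality up to the length of the latter ideal,
    which is at most that of any smaller one. *)
Lemma len_combine_ge x z K L D : is_ideal K -> is_ideal L -> is_ideal D ->
  (forall a, x * a = 0 -> a = 0) ->
  (forall a, principal x (z * a) -> principal x a) ->
  finite_length (pair_ideal x z) ->
  finite_length K -> finite_length L -> finite_length D ->
  (forall a, D a -> L (x * a)) -> (forall a, D a -> K (z * a)) ->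
  (len (pair_ideal x z) + len K + len L <=
     len (idsum (idscale x K) (idscale z L)) + len D)%N.
Proof.
move=> iK iL iD regx regz fxz fK fL fD DL DK.
have ip := is_ideal_principal; have isc := @is_ideal_scale R.
have [fB _] := len_combine_le iK iL fxz fK fL.
set B := idsum _ _ in fB *.
have iB : is_ideal B by exact: is_ideal_combine.
have EB' : idsum (principal x) B = idsum (principal x) (idscale z L).
  apply/seteqP; split; last first.
    by apply: sumS => //; apply: sub_sumR; exact: isc.
  apply: sum_sub; first by apply: is_ideal_sum => //; exact: isc.
    by apply: sub_sumL; exact: isc.
  apply: sumS => // _ [k _ <-]; exact: principal_mem.
set B' := idsum (principal x) (idscale z L) in EB'.
have iB' : is_ideal B' by apply: is_ideal_sum => //; exact: isc.
have fB' : finite_length B'.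
  by rewrite -EB'; apply: finite_length_sub fB => //;
    [rewrite EB' | apply: sub_sumR].
have Exz : idsum (principal z) B' = pair_ideal x z.
  apply/seteqP; split.
    apply: sum_sub; first exact: is_ideal_pair.
      by apply: principal_sub; [exact: is_ideal_pair | exact: pair_idealR].
    by apply: sumS => // _ [k _ <-]; exact: principal_mem.
  rewrite /pair_ideal idsumC; apply: sumS => //.
  by apply: sub_sumL; exact: isc.
have l1 := len_principal_split x iB fB; rewrite EB' in l1.
have l2 := len_principal_split z iB' fB'; rewrite Exz in l2.
have l3 := len_principal_split x iL fL.
have l4 : (len (idsum (principal x) L) <= len (colon B' z))%N.
  apply: len_sub; [exact: is_ideal_colon | exact: is_ideal_sum | |
    exact: finite_length_colon].
  move=> a [_ [_ [[u _ <-] [k Lk <-] E]]].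
  have : principal x (z * (a - k)) by rewrite mulrBr E addrK; exact: principal_mem.
  move=> /regz ha; exists (a - k), k; split=> //; by rewrite subrK.
pose T := colon L x; have iT : is_ideal T by exact: is_ideal_colon.
have fT : finite_length T by exact: finite_length_colon.
have l5 : (len (idsum (idscale z T) K) <= len (colon B x))%N.
  apply: len_sub; [exact: is_ideal_colon | | | exact: finite_length_colon].
    by apply: is_ideal_sum => //; exact: isc.
  move=> a [_ [_ [[k Kk <-] [l Ll <-] E]]].
  have : principal x (z * l).
    have -> : z * l = x * (a - k) by rewrite mulrBr E addrC addKr.
    exact: principal_mem.
  move=> /regz[u _ Eu]; exists (z * u), k; split=> //.
    by exists u => //; rewrite /T /colon /= Eu.
  apply/eqP; rewrite -subr_eq0; apply/eqP; apply: regx.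
  by rewrite mulrBr E mulrDr -Eu; ring.
have l6 := len_scale z iT iK fT fK.
have l7 : (len (T `&` colon K z) <= len D)%N.
  apply: len_sub => //; first by apply: is_ideal_setI => //; exact: is_ideal_colon.
  by move=> a Da; split; [exact: DL | exact: DK].
rewrite /T in l5 l6 l7 *; lia.
Qed.

End Length.
(** * Finite length and regular sequences in a local ring *)

Section Local.
Variables (R : comNzRingType) (m : set R).
Hypothesis hloc : noetherian_local m.
Implicit Types (A B C Q : set R) (t u v w x y z a b c : R).

Let nR : noetherian R. Proof. by case: hloc. Qed.
Let mm : maximal_ideal m. Proof. by case: hloc. Qed.
Let mloc : forall M : set R, maximal_ideal M -> M = m. Proof. by case: hloc. Qed.
Let im : is_ideal m. Proof. by case: mm. Qed.

Lemma finite_length_max : finite_length m.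
Proof.
have [|//|n _ hn] := @max_chain_exists _ (interval m setT) 1; last first.
- by exists n; rewrite has_length_interval.
- move=> [|[|k]] P [CP sP] //; have [_ m0 _] := CP 0%N isT.
  have [i1 m1 _] := CP 1%N isT; have [s01 n01] := sP 0%N isT.
  have [_ []] := sP 1%N isT; case: mm => _ _ /(_ _ i1 m1)[E|-> //].
  by case: n01; rewrite E.
- by exists m; split.
Qed.

(** Adding the generators of [A] to [A B] one at a time, each step is a quotient
    of [R / B]. *)
Lemma finite_length_mul A B : is_ideal A -> is_ideal B ->
  finite_length A -> finite_length B -> finite_length (ideal_mul A B).
Proof.
move=> iA iB fA fB; have [s Es] := nR iA.
have iAB := is_ideal_mul A B.
suff key (t : seq R) : [set` t] `<=` A ->
    finite_length (idsum (ideal_gen [set` t]) (ideal_mul A B)) ->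
    finite_length (ideal_mul A B).
  apply: (key s); first by rewrite Es; exact: sub_ideal_gen.
  rewrite -Es; apply: finite_length_sub fA => //; first exact: is_ideal_sum.
  exact: sub_sumL.
elim: t => [_|a t IH tA].
  rewrite ideal_gen_nil; apply: finite_length_sub => //.
    by rewrite -ideal_gen_nil; apply: is_ideal_sum => //; exact: is_ideal_gen.
  by apply: sum_sub => // _ ->; exact: ideal0.
move=> f; apply: IH; first by move=> x xt; apply: tA; rewrite /= inE; apply/orP; right.
have ig := is_ideal_gen [set` t].
have iC : is_ideal (idsum (ideal_gen [set` t]) (ideal_mul A B)) by exact: is_ideal_sum.
have [] // := @len_cover _ B (idsum (ideal_gen [set` a :: t]) (ideal_mul A B))
  (idsum (ideal_gen [set` t]) (ideal_mul A B)) a.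
- by apply: is_ideal_sum => //; exact: is_ideal_gen.
- move=> b Bb; apply: sub_sumR => //; apply: ideal_mul_mem => //.
  by apply: tA; rewrite /= inE eqxx.
- rewrite ideal_gen_cons => _ [_ [c [[p [q [pp qq ->]]] hc ->]]].
  exists p, (q + c); rewrite addrA; split=> //.
  by exists q, c.
Qed.

(** For a generator [a] of [m] with [a^n \in A], the steps from [A + (a^(k+1))] to
    [A + (a^k)] are quotients of [R / (A + (a))]; so [a] may be adjoined to [A]. *)
Lemma finite_length_radical A : is_ideal A ->
  (forall x, m x -> exists n, A (x ^+ n)) -> finite_length A.
Proof.
move=> iA hA; have [s Es] := nR im.
suff key (t : seq R) : [set` t] `<=` m ->
    finite_length (idsum (ideal_gen [set` t]) A) -> finite_length A.
  apply: (key s); first by rewrite Es; exact: sub_ideal_gen.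
  rewrite -Es; apply: finite_length_sub finite_length_max => //.
    exact: is_ideal_sum.
  exact: sub_sumL.
elim: t => [_|a t IH tm f].
  rewrite ideal_gen_nil; apply: finite_length_sub => //.
    by rewrite -ideal_gen_nil; apply: is_ideal_sum => //; exact: is_ideal_gen.
  by apply: sum_sub => // _ ->; exact: ideal0.
apply: IH; first by move=> x xt; apply: tm; rewrite /= inE; apply/orP; right.
set B := idsum (ideal_gen [set` t]) A.
have iB : is_ideal B by apply: is_ideal_sum => //; exact: is_ideal_gen.
have ip := @is_ideal_principal R.
have fa : finite_length (idsum (principal a) B).
  apply: finite_length_sub f; last first.
  - rewrite ideal_gen_cons => _ [_ [c [[p [q [pp qq ->]]] hc ->]]].
    by exists p, (q + c); rewrite addrA; split=> //; exists q, c.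
  - exact: is_ideal_sum.
  - by apply: is_ideal_sum => //; exact: is_ideal_gen.
have fp n : finite_length (idsum (principal (a ^+ n)) B).
  elim: n => [|n IHn].
    rewrite expr0; have -> : idsum (principal 1) B = setT; last exact: finite_length_setT.
    apply: ideal_full; first exact: is_ideal_sum.
    by apply: sub_sumL => //; exact: principal_id.
  have [] // := @len_cover _ (idsum (principal a) B) (idsum (principal (a ^+ n)) B)
    (idsum (principal (a ^+ n.+1)) B) (a ^+ n); try exact: is_ideal_sum.
  - apply: sum_sub; first by apply: is_ideal_colon; exact: is_ideal_sum.
      apply: principal_sub; first by apply: is_ideal_colon; exact: is_ideal_sum.
      rewrite /colon /= -exprSr; apply: sub_sumL => //; exact: principal_id.
    by move=> x Bx; apply: idealM; [exact: is_ideal_sum | exact: sub_sumR].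
  - by apply: sumS => // x Bx; apply: sub_sumR.
have [n An] : exists n, A (a ^+ n) by apply: hA; apply: tm; rewrite /= inE eqxx.
apply: finite_length_sub (fp n) => //; first exact: is_ideal_sum.
apply: sum_sub => //; apply: principal_sub => //.
by apply: sub_sumR => //; exact: is_ideal_gen.
Qed.

(** The lengths of [R/(A + z^n R)] increase with [n] and are bounded, so that
    [z^n] lies in [A + z^(n+1) R] for some [n]. *)
Lemma finite_length_power A z : is_ideal A -> finite_length A -> m z ->
  exists n, A (z ^+ n).
Proof.
move=> iA fA mz; pose B n := idsum (principal (z ^+ n)) A.
have ip := @is_ideal_principal R.
have iB n : is_ideal (B n) by exact: is_ideal_sum.
have fB n : finite_length (B n) by apply: finite_length_sub fA => //; exact: sub_sumR.
have sB n : B n.+1 `<=` B n.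
  apply: sumS => //; apply: principal_sub => //.
  by rewrite exprSr; exact: principal_mem.
have [n hn] : exists n, (length_quot (B n.+1) <= length_quot (B n))%N.
  apply: contrapT => no.
  have h n : (n <= length_quot (B n))%N.
    elim: n => // n IH; apply: leq_ltn_trans IH _; rewrite ltnNge; apply/negP => h.
    by apply: no; exists n.
  have := leq_trans (h (length_quot A).+1) (len_sub iA (iB _) (sub_sumR (ip _) (B := A)) fA).
  by rewrite ltnn.
have E := len_eq (iB _) (iB _) (sB n) (fB _) hn.
exists n; have : B n (z ^+ n) by apply: sub_sumL => //; exact: principal_id.
rewrite -E => -[_ [b [[c _ <-] Ab h]]].
apply: (absorb nR mm mloc iA (c := z * c) _ Ab); first exact: idealMr.
by rewrite {1}h exprS; ring.
Qed.

Lemma m_primary_ideal Q : m_primary m Q -> is_ideal Q.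
Proof. by case=> -[]. Qed.

Lemma m_primary_sub Q : m_primary m Q -> Q `<=` m.
Proof. by move=> [_ <-] x Qx; exists 1%N; rewrite expr1. Qed.

Lemma m_primary_finite_length Q : m_primary m Q -> finite_length Q.
Proof.
by move=> [[iQ _ _] E]; apply: finite_length_radical => // x; rewrite -E.
Qed.

Lemma finite_length_exp Q n : is_ideal Q -> finite_length Q ->
  finite_length (ideal_exp Q n).
Proof.
move=> iQ fQ; elim: n => [|n IH]; first exact: finite_length_setT.
by apply: finite_length_mul => //; exact: is_ideal_exp.
Qed.

Definition regular1 x := forall a, x * a = 0 -> a = 0.
Definition regular2 x y := forall a, principal x (y * a) -> principal x a.

Lemma regular1_exp x n : regular1 x -> regular1 (x ^+ n).
Proof.
move=> rx; elim: n => [|n IH] a; first by rewrite mul1r.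
by rewrite exprS -mulrA => /rx /IH.
Qed.

Lemma regular2_expr x y n : regular2 x y -> regular2 x (y ^+ n).
Proof.
move=> rxy; elim: n => [|n IH] a; first by rewrite mul1r.
by rewrite exprS -mulrA => /rxy /IH.
Qed.

Lemma regular2_expl x y n : regular1 x -> regular2 x y -> regular2 (x ^+ n) y.
Proof.
move=> rx rxy; elim: n => [|n IH] a.
  by move=> _; exists a => //; rewrite mul1r.
move=> [b _ E]; have [a' _ Ea] : principal x a.
  by apply: rxy; rewrite -E exprS -mulrA; exact: principal_mem.
have [c _ Ec] : principal (x ^+ n) a'.
  apply: IH; exists b => //; apply/eqP; rewrite -subr_eq0; apply/eqP; apply: rx.
  by rewrite mulrBr mulrA -exprS E -Ea; ring.
by exists c => //; rewrite exprS -mulrA Ec.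
Qed.

Lemma regular1_of_finite_length z x : regular1 z -> m z ->
  finite_length (principal x) -> regular1 x.
Proof.
move=> rz mz fx a xa0.
have [n [c _ E]] := finite_length_power (is_ideal_principal x) fx mz.
by apply: (regular1_exp (n := n) rz); rewrite -E mulrAC xa0 mul0r.
Qed.

(** If [x a = 0], then expressing the terms of a regular sequence in [x], [y] and
    eliminating shows [a \in (y)].  This applies with any power of [y], so that
    Krull's intersection theorem gives [a = 0]. *)
Lemma regular1_of_pair z w x y : regular1 z -> regular2 z w -> m z -> m w ->
  m y -> finite_length (pair_ideal x y) -> regular1 x.
Proof.
move=> rz rzw mz mw my fxy a xa0.
apply: (krull_intersection_principal nR mm mloc my) => k.
have fxk : finite_length (pair_ideal x (y ^+ k)).
  by rewrite pair_idealC; have [] := len_pair_exp k (u := y) (b := x); rewrite 1?pair_idealC.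
have iP := is_ideal_pair x (y ^+ k).
have [i [_ [_ [[p _ <-] [q _ <-] Ez]]]] := finite_length_power iP fxk mz.
have [j [_ [_ [[p' _ <-] [q' _ <-] Ew]]]] := finite_length_power iP fxk mw.
have rz' := regular1_exp (n := i) rz.
have rzw' := regular2_expr (n := j) (regular2_expl (n := i) rz rzw).
have za : z ^+ i * a = y ^+ k * (q * a).
  by rewrite Ez mulrDl mulrAC xa0 mul0r add0r mulrA.
have wa : w ^+ j * a = y ^+ k * (q' * a).
  by rewrite Ew mulrDl mulrAC xa0 mul0r add0r mulrA.
have [b _ Eb] : principal (z ^+ i) (q * a).
  apply: rzw'; exists (q' * a) => //.
  by rewrite mulrCA za mulrCA [RHS]mulrCA wa; ring.
exists b; apply/eqP; rewrite -subr_eq0; apply/eqP; apply: rz'.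
by rewrite mulrBr za [z ^+ i * (_ * b)]mulrCA Eb subrr.
Qed.

(** If [y c \in (x)], then [c] is annihilated modulo [x] by all of [(x, y)], hence
    by powers [z^i], [w^j] of the regular sequence.  Writing [z^i c = x p] and
    [w^j c = x q] gives [w^j p = z^i q], so that [z^i] divides [p]. *)
Lemma regular2_of_pair z w x y : regular1 z -> regular2 z w -> m z -> m w ->
  m y -> finite_length (pair_ideal x y) -> regular2 x y.
Proof.
move=> rz rzw mz mw my fxy c [d _ hd].
have rx := regular1_of_pair rz rzw mz mw my fxy.
have iP := is_ideal_pair x y.
have inx n u : pair_ideal x y (u ^+ n) -> principal x (u ^+ n * c).
  move=> [_ [_ [[p _ <-] [q _ <-] ->]]]; exists (p * c + q * d) => //.
  by rewrite mulrDr mulrDl [x * (q * d)]mulrCA hd; ring.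
have [i /inx[p _ Ep]] := finite_length_power iP fxy mz.
have [j /inx[q _ Eq]] := finite_length_power iP fxy mw.
have rz' := regular1_exp (n := i) rz.
have rzw' := regular2_expr (n := j) (regular2_expl (n := i) rz rzw).
have [p' _ Ep'] : principal (z ^+ i) p.
  apply: rzw'; exists q => //; apply/eqP; rewrite -subr_eq0; apply/eqP; apply: rx.
  by rewrite mulrBr mulrCA Eq [x * (w ^+ j * p)]mulrCA Ep; ring.
exists p' => //; apply/eqP; rewrite -subr_eq0; apply/eqP; apply: rz'.
by rewrite mulrBr -Ep -Ep'; ring.
Qed.

End Local.

(** * Cohen-Macaulay local rings of dimension one and two *)

Section CohenMacaulay.
Variables (R : comNzRingType) (m : set R).
Hypothesis hR : cohen_macaulay_local m.
Implicit Types (x y z w : R).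

Let hloc : noetherian_local m. Proof. by case: hR. Qed.

Lemma cm_regular_sequence d : krull_dim R d ->
  exists s : seq R, [/\ regular_sequence s, [set` s] `<=` m & size s = d].
Proof.
by move=> hd; case: hR => _ [n [hn [hs _]]]; rewrite -(max_chain_uniq hn hd).
Qed.

Lemma cm_regular1 x : krull_dim R 1 -> finite_length (principal x) -> regular1 x.
Proof.
move=> /cm_regular_sequence[[|z [|? ?]] [[_ rs] sm // _]].
apply: (regular1_of_finite_length hloc (z := z)); last first.
  by apply: sm; rewrite /= inE.
move=> a za0; have := rs 0%N isT a; rewrite /= ideal_gen_nil; exact.
Qed.

Lemma cm_regular2 x y : krull_dim R 2 -> m y -> finite_length (pair_ideal x y) ->
  regular1 x /\ regular2 x y.
Proof.
move=> /cm_regular_sequence[[|z [|w [|? ?]]] [[_ rs] sm // _]] my fxy.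
have mz : m z by apply: sm; rewrite /= inE eqxx.
have mw : m w by apply: sm; rewrite /= !inE eqxx orbT.
have rz : regular1 z.
  move=> a za0; have := rs 0%N isT a; rewrite /= ideal_gen_nil; exact.
have rzw : regular2 z w by move=> a; have := rs 1%N isT a; rewrite /= ideal_gen1.
split; first exact: (regular1_of_pair hloc rz rzw mz mw my).
exact: (regular2_of_pair hloc rz rzw mz mw my).
Qed.

End CohenMacaulay.
(** * The ascending chain condition for bigraded ideals of a Rees algebra *)

Section HilbertBasis.
Variable S : comNzRingType.
Implicit Types (A B N : set S) (u x y c : S) (p q : {poly S}).

Definition subring_set A : Prop :=
  [/\ A 1, A (- 1), forall x y, A x -> A y -> A (x + y)
    & forall x y, A x -> A y -> A (x * y)].

Definition submodule A N : Prop :=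
  [/\ N 0, forall x y, N x -> N y -> N (x + y)
    & forall c x, A c -> N x -> N (c * x)].

Definition noetherian_subring A : Prop :=
  subring_set A /\
  forall N : nat -> set S, (forall n, submodule A (N n)) ->
    (forall n, N n `<=` A) -> (forall n, N n `<=` N n.+1) ->
    exists n, forall k, (n <= k)%N -> N k `<=` N n.

Definition poly_over A p := forall i, A p`_i.

Definition adjoin A u : set S := [set p.[u] | p in poly_over A].

(** Leading coefficients of the elements of [N] that are polynomials in [u] of
    degree at most [n]; such an expression need not be unique. *)
Definition lead A u N n : set S :=
  [set c | A c /\
    exists p, [/\ poly_over A p, (size p <= n)%N & N (c * u ^+ n + p.[u])]].

Lemma subring_set0 A : subring_set A -> A 0.
Proof. by move=> [A1 A1' AD _]; rewrite -(subrr 1); exact: AD. Qed.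

Lemma poly_overD A p q : subring_set A ->
  poly_over A p -> poly_over A q -> poly_over A (p + q).
Proof. by move=> [_ _ AD _] hp hq i; rewrite coefD; exact: AD. Qed.

Lemma poly_overM A p q : subring_set A ->
  poly_over A p -> poly_over A q -> poly_over A (p * q).
Proof.
move=> sA hp hq i; rewrite coefM; have [_ _ AD AM] := sA.
apply: big_ind => //; first exact: subring_set0.
by move=> j _; exact: AM.
Qed.

Lemma poly_overC A c : subring_set A -> A c -> poly_over A c%:P.
Proof. by move=> sA Ac i; rewrite coefC; case: eqP => // _; exact: subring_set0. Qed.

Lemma poly_overX A : subring_set A -> poly_over A 'X.
Proof.
by move=> sA i; rewrite coefX; case: eqP => _; [case: sA | exact: subring_set0].
Qed.

Lemma sub_adjoin A u : subring_set A -> A `<=` adjoin A u.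
Proof. by move=> sA c Ac; exists c%:P; [exact: poly_overC | rewrite hornerC]. Qed.

Lemma adjoin_gen A u : subring_set A -> adjoin A u u.
Proof. by move=> sA; exists 'X; [exact: poly_overX | rewrite hornerX]. Qed.

Lemma subring_adjoin A u : subring_set A -> subring_set (adjoin A u).
Proof.
move=> sA; have [A1 A1' AD AM] := sA; split; try exact: sub_adjoin.
- move=> _ _ [p hp <-] [q hq <-]; exists (p + q); last by rewrite hornerD.
  exact: poly_overD.
- move=> _ _ [p hp <-] [q hq <-]; exists (p * q); last by rewrite hornerM.
  exact: poly_overM.
Qed.

Lemma subring_sum A n (F : 'I_n -> S) : subring_set A ->
  (forall i, A (F i)) -> A (\sum_i F i).
Proof.
move=> sA hF; have [_ _ AD _] := sA.
by elim/big_ind: _ => //; exact: subring_set0.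
Qed.

Lemma adjoin_sub A B u : subring_set B -> A `<=` B -> B u -> adjoin A u `<=` B.
Proof.
move=> sB AB Bu _ [p hp <-]; rewrite horner_coef; apply: subring_sum => // i.
have [B1 _ _ BM] := sB; apply: (BM); first exact/AB/hp.
by elim: (val i) => [|n IHn]; rewrite ?expr0 // exprS; exact: BM.
Qed.

Lemma submodule_lead A u N n : subring_set A -> submodule (adjoin A u) N ->
  submodule A (lead A u N n).
Proof.
move=> sA [N0 ND NM]; have A0 := subring_set0 sA; have [_ _ AD AM] := sA; split.
- split=> //; exists 0; split=> [i||]; rewrite ?coef0 ?size_poly0 //.
  by rewrite horner0 mul0r addr0.
- move=> x y [Ax [p [hp sp Np]]] [Ay [q [hq sq Nq]]]; split; first exact: AD.
  exists (p + q); split; first exact: poly_overD.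
    by apply: leq_trans (size_polyD _ _) _; rewrite geq_max sp.
  rewrite hornerD mulrDl addrACA; exact: ND.
- move=> c x Ac [Ax [p [hp sp Np]]]; split; first exact: AM.
  exists (c%:P * p); split; first by apply: poly_overM => //; exact: poly_overC.
    by rewrite mul_polyC; apply: leq_trans (size_scale_leq _ _) sp.
  by rewrite hornerM hornerC -mulrA -mulrDr; apply: NM => //; exact: sub_adjoin.
Qed.

Lemma lead_succ A u N n : subring_set A -> submodule (adjoin A u) N ->
  lead A u N n `<=` lead A u N n.+1.
Proof.
move=> sA [N0 ND NM] c [Ac [p [hp sp Np]]]; split=> //; exists ('X * p); split.
- by apply: poly_overM => //; exact: poly_overX.
- by apply: leq_trans (size_polyMleq _ _) _; rewrite size_polyX.
- rewrite hornerM hornerX exprS [_ * (u * _)]mulrCA -mulrDr; apply: NM => //.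
  exact: adjoin_gen.
Qed.

Lemma leadS A u N N' n : N `<=` N' -> lead A u N n `<=` lead A u N' n.
Proof. by move=> h c [Ac [p [hp sp Np]]]; split=> //; exists p; split=> //; exact: h. Qed.

(** Induction on the degree: subtracting an element of [N] with the same leading
    coefficient lowers the degree of an element of [N']. *)
Lemma lead_eq A u N N' : subring_set A -> submodule (adjoin A u) N ->
  submodule (adjoin A u) N' -> N `<=` N' -> N' `<=` adjoin A u ->
  (forall n, lead A u N' n `<=` lead A u N n) -> N' `<=` N.
Proof.
move=> sA [N0 ND NM] [N0' ND' NM'] NN' sN' hl.
have A0 := subring_set0 sA; have [A1 A1' AD AM] := sA.
suff h n p : poly_over A p -> (size p <= n)%N -> N' p.[u] -> N p.[u].
  by move=> x N'x; have [p hp E] := sN' x N'x; rewrite -E in N'x *; exact: h hp (leqnn _) N'x.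
elim: n p => [|n IH] p hp sp Np.
  by move: sp; rewrite leqn0 size_poly_eq0 => /eqP ->; rewrite horner0.
pose p' := \poly_(i < n) p`_i.
have hp' : poly_over A p' by move=> i; rewrite coef_poly; case: ifP.
have Ep : p.[u] = p`_n * u ^+ n + p'.[u].
  by rewrite (horner_coef_wide u sp) big_ord_recr /= horner_poly addrC.
have [_ [r [hr sr Nr]]] : lead A u N n p`_n.
  apply: hl; split=> //; exists p'; split=> //; first exact: size_poly.
  by rewrite -Ep.
have hd : poly_over A (p' + (- 1)%:P * r).
  by apply: poly_overD => //; apply: poly_overM => //; exact: poly_overC.
have Ed : (p' + (- 1)%:P * r).[u] = p.[u] + (- 1) * (p`_n * u ^+ n + r.[u]).
  by rewrite Ep hornerD hornerM hornerC; ring.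
have -> : p.[u] = (p' + (- 1)%:P * r).[u] + (p`_n * u ^+ n + r.[u]).
  by rewrite Ed; ring.
apply: ND => //; apply: IH => //.
  apply: leq_trans (size_polyD _ _) _; rewrite geq_max size_poly mul_polyC.
  exact: leq_trans (size_scale_leq _ _) sr.
rewrite Ed; apply: ND' => //; apply: NM'; last exact: NN'.
exact: sub_adjoin.
Qed.

(** Hilbert's basis theorem: along a chain of ideals [N n], the ideals of leading
    coefficients stabilize in all degrees at once, by looking at the diagonal
    chain [lead (N n) n] for the large degrees and at the finitely many remaining
    degrees one by one. *)
Theorem noetherian_adjoin A u : noetherian_subring A -> noetherian_subring (adjoin A u).
Proof.
move=> [sA nA]; split; first exact: subring_adjoin.
move=> N hN sN mN; have mono := nondec_chain mN.
have subA n k : lead A u (N k) n `<=` A by move=> c [].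
have monol k : forall i j, (i <= j)%N -> lead A u (N k) i `<=` lead A u (N k) j.
  by apply: nondec_chain => n; exact: lead_succ.
have [p0 hp0] : exists n, forall k, (n <= k)%N ->
    lead A u (N k) k `<=` lead A u (N n) n.
  apply: (nA (fun n => lead A u (N n) n)) => // n; first exact: submodule_lead.
  by apply: subset_trans (lead_succ sA (hN n.+1)); exact: leadS.
have [q hq] : exists q : nat, forall i, (i < p0)%N -> forall k, (q <= k)%N ->
    lead A u (N k) i `<=` lead A u (N q) i.
  elim: (p0) => [|l [q hq]]; first by exists 0%N.
  have [n hn] : exists n, forall k, (n <= k)%N ->
      lead A u (N k) l `<=` lead A u (N n) l.
    apply: (nA (fun k => lead A u (N k) l)) => // n; first exact: submodule_lead.
    exact: leadS.
  exists (maxn q n) => i; rewrite ltnS leq_eqVlt => /orP[/eqP ->|il] k;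
    rewrite geq_max => /andP[qk nk].
    by apply: subset_trans (hn k nk) _; apply: leadS; apply: mono; exact: leq_maxr.
  by apply: subset_trans (hq i il k qk) _; apply: leadS; apply: mono; exact: leq_maxl.
exists (maxn p0 q) => k; rewrite geq_max => /andP[pk qk].
apply: (@lead_eq A u) => //.
  by apply: mono; rewrite geq_max pk.
move=> i; have [ip|pi] := ltnP i p0.
  apply: subset_trans (hq i ip k qk) _; apply: leadS; apply: mono; exact: leq_maxr.
apply: (@subset_trans _ (lead A u (N (maxn k i)) (maxn k i))).
  by apply: subset_trans (monol _ _ _ (leq_maxr k i)); apply: leadS; apply: mono; exact: leq_maxl.
apply: subset_trans (hp0 _ _) _; first by rewrite leq_max pk.
apply: subset_trans (monol _ _ _ pi) _; apply: leadS; apply: mono; exact: leq_maxl.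
Qed.

End HilbertBasis.

Definition product_ideal (R : comNzRingType) (I J : set R) (r s : nat) : set R :=
  ideal_mul (ideal_exp I r) (ideal_exp J s).

(** The homogeneous ideals of the Rees algebra of [I] and [J], given by their
    components. *)
Definition rees_family (R : comNzRingType) (I J : set R)
    (E : nat -> nat -> set R) : Prop :=
  [/\ forall r s, is_ideal (E r s),
      forall r s, E r s `<=` product_ideal I J r s
    & forall r s a b c x, product_ideal I J a b c -> E r s x ->
        E (a + r)%N (b + s)%N (c * x)].

Section ReesFamilies.
Variable R : comNzRingType.
Implicit Types (I J : set R) (E M : nat -> nat -> set R) (a b c v w x y : R).

Lemma is_ideal_product I J r s : is_ideal (product_ideal I J r s).
Proof. exact: is_ideal_mul. Qed.

Lemma product_idealC I J r s : product_ideal I J r s = product_ideal J I s r.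
Proof. exact: ideal_mulC. Qed.

Lemma product_ideal_mul I J r s i j x y :
  product_ideal I J r s x -> product_ideal I J i j y ->
  product_ideal I J (r + i) (s + j) (x * y).
Proof.
have iP := is_ideal_product I J.
move=> hx hy; have : product_ideal I J r s `<=`
    colon (product_ideal I J (r + i) (s + j)) y.
  apply: ideal_mul_sub; first exact: is_ideal_colon.
  move=> c d hc hd; rewrite /colon /=; move: hy.
  have : product_ideal I J i j `<=`
      colon (product_ideal I J (r + i) (s + j)) (c * d).
    apply: ideal_mul_sub; first exact: is_ideal_colon.
    move=> e f he hf; rewrite /colon /= mulrACA; apply: ideal_mul_mem; exact: ideal_exp_mul.
  by move=> /[apply]; rewrite /colon /= mulrC.
by move=> /(_ _ hx); rewrite /colon /= mulrC.
Qed.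

Lemma product_ideal00 I J : product_ideal I J 0 0 = setT.
Proof.
apply: ideal_full; first exact: is_ideal_product.
by rewrite -(mulr1 1); exact: ideal_mul_mem.
Qed.

Lemma product_ideal_mem I J r s a b : ideal_exp I r a -> ideal_exp J s b ->
  product_ideal I J r s (a * b).
Proof. exact: ideal_mul_mem. Qed.

Lemma ideal_exp1 I a : I a -> ideal_exp I 1 a.
Proof. by move=> Ia; rewrite -(mulr1 a); exact: ideal_mul_mem. Qed.

Lemma product_ideal10 I J a : I a -> product_ideal I J 1 0 a.
Proof. by move=> Ia; rewrite -(mulr1 a); apply: ideal_mul_mem => //; exact: ideal_exp1. Qed.

Lemma product_ideal01 I J a : J a -> product_ideal I J 0 1 a.
Proof. by move=> Ja; rewrite -(mul1r a); apply: ideal_mul_mem => //; exact: ideal_exp1. Qed.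

Lemma rees_product I J : rees_family I J (product_ideal I J).
Proof.
split=> [r s|r s x //|r s i j c x]; first exact: is_ideal_product.
exact: product_ideal_mul.
Qed.

Lemma rees_swap I J E : rees_family I J E -> rees_family J I (fun r s => E s r).
Proof.
move=> [iE sE mE]; split=> [r s|r s|r s i j c x]; first exact: iE.
  by rewrite product_idealC; exact: sE.
by rewrite product_idealC; exact: mE.
Qed.

Definition bimonomial v r s : {poly {poly R}} := (v *: 'X^s)%:P * 'X^r.

Lemma bimonomialE v r s i j :
  (bimonomial v r s)`_i`_j = if (i == r) && (j == s) then v else 0.
Proof.
rewrite /bimonomial coefCM coefXn; case: eqP => _; last by rewrite mulr0 coef0.
by rewrite mulr1 coefZ coefXn; case: eqP => _; rewrite ?mulr1 ?mulr0.
Qed.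

Lemma bimonomialM v w r s i j :
  bimonomial v r s * bimonomial w i j = bimonomial (v * w) (r + i) (s + j).
Proof. by rewrite /bimonomial mulrACA -polyCM -scalerAl -scalerAr scalerA -!exprD. Qed.

Lemma bimonomialD v w r s :
  bimonomial (v + w) r s = bimonomial v r s + bimonomial w r s.
Proof. by rewrite /bimonomial scalerDl polyCD mulrDl. Qed.

Lemma bimonomial_sum (f : {poly {poly R}}) :
  f = \sum_(i < size f) \sum_(j < size f`_i) bimonomial f`_i`_j i j.
Proof.
rewrite -{1}[f]coefK poly_def; apply: eq_bigr => i _.
rewrite -mul_polyC -{1}[f`_i]coefK poly_def rmorph_sum /= mulr_suml.
by apply: eq_bigr.
Qed.

(** The homogeneous ideal of [R[t1, t2]] with components [E r s]; for products of
    powers this is the Rees algebra itself. *)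
Definition total E : set {poly {poly R}} := [set f : {poly {poly R}} | forall r s, E r s f`_r`_s].

Lemma total_mul I J E (f g : {poly {poly R}}) : rees_family I J E ->
  total (product_ideal I J) f -> total E g -> total E (f * g).
Proof.
move=> [iE _ mE] hf hg r s; rewrite coefM coef_sum; apply: ideal_sum => // i _.
rewrite coefM; apply: ideal_sum => // j _.
rewrite -{1}(subnKC (leq_ord i)) -{1}(subnKC (leq_ord j)).
by apply: mE; [exact: hf | exact: hg].
Qed.

Lemma subring_total I J : subring_set (total (product_ideal I J)).
Proof.
have iP := is_ideal_product I J.
have mono1 v : total (product_ideal I J) (bimonomial v 0 0).
  move=> r s; rewrite bimonomialE; case: ifP => [|_]; last exact: ideal0.
  by move=> /andP[/eqP -> /eqP ->]; rewrite product_ideal00.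
have E v : bimonomial v 0 0 = v%:P%:P by rewrite /bimonomial !expr0 mulr1 alg_polyC.
split; first by rewrite -[1]/(1%:P%:P) -E.
- by rewrite -[1]/(1%:P%:P) -!polyCN -E.
- by move=> f g hf hg r s; rewrite !coefD; apply: idealD (hf r s) (hg r s).
- by move=> f g hf hg; exact: total_mul (rees_product I J) hf hg.
Qed.

Lemma noetherian_constants : noetherian R ->
  noetherian_subring (range (fun c : R => c%:P%:P)).
Proof.
move=> nR; split.
  split; first by exists 1.
  - by exists (-1) => //; rewrite !polyCN.
  - by move=> _ _ [x _ <-] [y _ <-]; exists (x + y) => //; rewrite !polyCD.
  - by move=> _ _ [x _ <-] [y _ <-]; exists (x * y) => //; rewrite !polyCM.
move=> N hN sN mN.
have [|k x|n hn] := @noetherian_chain R nR (fun n => [set c | N n c%:P%:P]).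
- move=> n; have [N0 ND NM] := hN n; split=> //.
  + by move=> x y /= hx hy; rewrite !polyCD; exact: ND.
  + by move=> a x /= hx; rewrite !polyCM; apply: NM => //; exists a.
- exact: mN.
exists n => k nk _ /[dup] /sN[c _ <-]; exact: hn.
Qed.

(** The Rees algebra is generated over [R] by the finitely many [a t1] and [b t2],
    for [a], [b] running through generators of [I], [J]. *)
Lemma noetherian_rees I J : noetherian R -> is_ideal I -> is_ideal J ->
  noetherian_subring (total (product_ideal I J)).
Proof.
move=> nR iI iJ; have [si Ei] := nR I iI; have [sj Ej] := nR J iJ.
pose A0 : set {poly {poly R}} := range (fun c : R => c%:P%:P).
pose gens := [seq bimonomial a 1 0 | a <- si] ++ [seq bimonomial b 0 1 | b <- sj].
pose B := foldr (fun u A => adjoin A u) A0 gens.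
have sT := subring_total I J; have iP := is_ideal_product I J.
have nB : noetherian_subring B.
  rewrite /B; elim: (gens) => [|u l IH] /=; first exact: noetherian_constants.
  exact: noetherian_adjoin.
have [B1 B1' BD BM] := nB.1.
suff -> : total (product_ideal I J) = B by [].
apply/seteqP; split; last first.
  have : forall u, u \in gens -> total (product_ideal I J) u.
    move=> u; rewrite mem_cat => /orP[] /mapP[a ha ->] r s; rewrite bimonomialE;
      (case: ifP => [/andP[/eqP -> /eqP ->]|_]; last exact: ideal0).
    + by apply: product_ideal10; rewrite Ei; exact: sub_ideal_gen.
    + by apply: product_ideal01; rewrite Ej; exact: sub_ideal_gen.
  rewrite /B; elim: (gens) => [|u l IH] hl /=.
    move=> _ [c _ <-] r s; have := bimonomialE c 0 0 r s.
    rewrite /bimonomial !expr0 mulr1 alg_polyC => ->.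
    by case: ifP => [/andP[/eqP -> /eqP ->]|_]; [rewrite product_ideal00 | exact: ideal0].
  apply: adjoin_sub => //; last by apply: hl; exact: mem_head.
  by apply: IH => v vl; apply: hl; rewrite inE vl orbT.
have sub0 : A0 `<=` B /\ forall u, u \in gens -> B u.
  rewrite /B; elim: (gens) => [|u l [IH1 IH2]]; first by split.
  have sl : subring_set (foldr (fun u A => adjoin A u) A0 l).
    elim: (l) => [|w l' IHl]; first by case: (noetherian_constants nR).
    exact: subring_adjoin.
  split=> /=; first by apply: subset_trans IH1 _; exact: sub_adjoin.
  move=> w; rewrite inE => /orP[/eqP ->|/IH2 h]; first exact: adjoin_gen.
  exact: sub_adjoin.
have [A0B gB] := sub0; have B0 := subring_set0 nB.1.
have const c : B (bimonomial c 0 0).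
  by apply: A0B; exists c => //; rewrite /bimonomial !expr0 mulr1 alg_polyC.
have idB r s : is_ideal [set v | B (bimonomial v r s)].
  split=> /= [|x y hx hy|a x hx].
  - by rewrite /bimonomial scale0r polyC0 mul0r.
  - by rewrite bimonomialD; exact: BD.
  - by rewrite -[r]add0n -[s]add0n -bimonomialM; exact: BM.
have BI a : I a -> B (bimonomial a 1 0).
  rewrite Ei; apply: (ideal_gen_sub (idB 1%N 0%N)) => x xs /=; apply: gB.
  by rewrite mem_cat; apply/orP; left; apply/mapP; exists x.
have BJ a : J a -> B (bimonomial a 0 1).
  rewrite Ej; apply: (ideal_gen_sub (idB 0%N 1%N)) => x xs /=; apply: gB.
  by rewrite mem_cat; apply/orP; right; apply/mapP; exists x.
have BIr r : ideal_exp I r `<=` [set v | B (bimonomial v r 0)].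
  elim: r => [|r IH]; first by move=> v _; exact: const.
  apply: ideal_mul_sub => // a b Ia /IH hb /=.
  by rewrite -[r.+1]add1n -[X in bimonomial _ _ X]addn0 -bimonomialM; apply: BM => //; exact: BI.
have BJs s : ideal_exp J s `<=` [set v | B (bimonomial v 0 s)].
  elim: s => [|s IH]; first by move=> v _; exact: const.
  apply: ideal_mul_sub => // a b Ja /IH hb /=.
  by rewrite -[s.+1]add1n -[X in bimonomial _ X _]addn0 -bimonomialM; apply: BM => //; exact: BJ.
have BP r s : product_ideal I J r s `<=` [set v | B (bimonomial v r s)].
  apply: ideal_mul_sub => // a b /BIr ha /BJs hb /=.
  by rewrite -[r]addn0 -[s]add0n -bimonomialM; exact: BM.
move=> f hf; rewrite (bimonomial_sum f).
by do 2!apply: (subring_sum nB.1) => ?; apply: BP; exact: hf.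
Qed.

Lemma rees_chain I J (E : nat -> nat -> nat -> set R) : noetherian R ->
  is_ideal I -> is_ideal J -> (forall n, rees_family I J (E n)) ->
  (forall n r s, E n r s `<=` E n.+1 r s) ->
  exists n, forall k r s, (n <= k)%N -> E k r s `<=` E n r s.
Proof.
move=> nR iI iJ hE mE; have [_ acc] := noetherian_rees nR iI iJ.
have [n|n f hf r s|n f hf r s|n hn] := acc (fun n => total (E n)).
- have [iE _ _] := hE n; split.
  + by move=> r s; rewrite !coef0; exact: ideal0.
  + by move=> f g hf hg r s; rewrite !coefD; apply: idealD (hf r s) (hg r s).
  + by move=> f g hf hg; exact: total_mul hf hg.
- by have [_ sE _] := hE n; exact: sE.
- exact: mE.
exists n => k r s nk v hv.
have : total (E n) (bimonomial v r s).
  apply: hn nk _ _ => i j; rewrite bimonomialE.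
  case: ifP => [/andP[/eqP -> /eqP -> //]|_].
  by have [iE _ _] := hE k; exact: ideal0.
by move=> /(_ r s); rewrite bimonomialE !eqxx.
Qed.

Lemma rees_ind I J (P : (nat -> nat -> set R) -> Prop) : noetherian R ->
  is_ideal I -> is_ideal J ->
  (forall E, rees_family I J E ->
    (forall E', rees_family I J E' -> (forall r s, E r s `<=` E' r s) ->
       (exists r s, ~ E' r s `<=` E r s) -> P E') -> P E) ->
  forall E, rees_family I J E -> P E.
Proof.
move=> nR iI iJ step; apply: (chain_ind
  (gt := fun E E' => [/\ rees_family I J E, rees_family I J E',
     forall r s, E r s `<=` E' r s & exists r s, ~ E' r s `<=` E r s])).
  move=> f h; have [n hn] := rees_chain nR iI iJ
    (fun n => let: And4 i _ _ _ := h n in i) (fun n => let: And4 _ _ i _ := h n in i).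
  by have [_ _ _ [r [s]]] := h n; apply; exact: hn.
by move=> E IH hE; apply: step => // E' hE' s1 s2; exact: IH.
Qed.

End ReesFamilies.
(** * Generic elements and joint reductions *)

(** A property of elements of [I] is generic if it holds outside finitely many
    ideals not containing [I]; over an infinite residue field this plays the
    role of a nonempty Zariski-open condition on [I / m I]. *)
Definition generic (R : comNzRingType) (I : set R) (P : R -> Prop) : Prop :=
  exists (n : nat) (B : nat -> set R),
    (forall i, (i < n)%N -> is_ideal (B i) /\ ~ I `<=` B i) /\
    forall x, I x -> (forall i, (i < n)%N -> ~ B i x) -> P x.

(** Injectivity of the multiplication by [x], of degree [(1, 0)], on the bigraded
    module [M / E] in large degrees. *)
Definition filter_regular (R : comNzRingType) (M E : nat -> nat -> set R)
    (x : R) (N : nat) : Prop :=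
  forall r s v, (N <= r)%N -> M r s v -> E r.+1 s (x * v) -> E r s v.

Section Generic.
Variables (R : comNzRingType) (m : set R).
Hypothesis hloc : noetherian_local m.
Hypothesis hk : infinite_set (residue_ring m).
Implicit Types (A B I J : set R) (P Q : R -> Prop).
Implicit Types (M E : nat -> nat -> set R) (x y z v c : R).

Let nR : noetherian R. Proof. by case: hloc. Qed.
Let mm : maximal_ideal m. Proof. by case: hloc. Qed.
Let mloc : forall M : set R, maximal_ideal M -> M = m. Proof. by case: hloc. Qed.
Let im : is_ideal m. Proof. by case: mm. Qed.

Lemma generic_imp I P Q : (forall x, I x -> P x -> Q x) -> generic I P -> generic I Q.
Proof.
move=> h [n [B [hB hP]]]; exists n, B; split=> // x Ix hx.
by apply: h => //; exact: hP.
Qed.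

Lemma generic_true I P : (forall x, I x -> P x) -> generic I P.
Proof. by move=> h; exists 0%N, (fun=> set0); split=> // x Ix _; exact: h. Qed.

Lemma generic_avoid I B : is_ideal B -> ~ I `<=` B -> generic I (fun x => ~ B x).
Proof. by move=> iB IB; exists 1%N, (fun=> B); split=> // x _ /(_ 0%N isT). Qed.

Lemma generic_and I P Q : generic I P -> generic I Q -> generic I (fun x => P x /\ Q x).
Proof.
move=> [n [B [hB hP]]] [k [D [hD hQ]]].
exists (n + k)%N, (fun i => if (i < n)%N then B i else D (i - n)%N); split.
  by move=> i ink; case: ltnP => ni; [exact: hB | apply: hD; lia].
move=> x Ix hx; split.
  by apply: hP => // i ni; have := hx i; rewrite ni; apply; lia.
apply: hQ => // i ki; have := hx (n + i)%N.
have -> : (n + i < n)%N = false by lia.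
by rewrite addKn; apply; rewrite ltn_add2l.
Qed.

(** Otherwise the residue field would consist of the classes of one
    representative of each [D i]. *)
Lemma residue_pigeonhole n (D : nat -> set R) :
  (forall i, (i < n)%N -> forall c c', D i c -> D i c' -> m (c - c')) ->
  exists c, forall i, (i < n)%N -> ~ D i c.
Proof.
move=> hD; apply: contrapT => no; apply: hk.
pose coset c := [set c + y | y in m].
apply: (@sub_finite_set _ _ [set coset (xget 0 (D i)) | i in `I_n]); last first.
  by apply: finite_image; exact: finite_II.
move=> _ [c _ <-].
have [i [ni Dc]] : exists i, (i < n)%N /\ D i c.
  apply: contrapT => h; apply: no; exists c => i ni Dc; apply: h.
  by exists i.
exists i => //; have Dx : D i (xget 0 (D i)) by exact: xgetI Dc.
apply/seteqP; split=> _ [y my <-].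
  exists (xget 0 (D i) - c + y); last by ring.
  by apply: idealD => //; exact: hD Dx Dc.
exists (c - xget 0 (D i) + y); last by ring.
by apply: idealD => //; exact: hD Dc Dx.
Qed.

(** Prime avoidance without primes: on a line [x + c y] each ideal that misses
    [x] excludes at most one residue class of [c]. *)
Lemma generic_ex I P : is_ideal I -> generic I P -> exists2 x, I x & P x.
Proof.
move=> iI [n [B [hB hP]]].
suff [x Ix hx] : exists2 x, I x & forall i, (i < n)%N -> ~ B i x.
  by exists x => //; exact: hP.
elim: n hB {hP} => [|n IH] hB; first by exists 0 => //; exact: ideal0.
have [|x Ix hx] := IH; first by move=> i ni; apply: hB; exact: ltnW.
have [iBn IBn] := hB n (leqnn _).
have [Bx|Bx] := pselect (B n x); last first.
  by exists x => // i; rewrite ltnS leq_eqVlt => /orP[/eqP ->|]; [|exact: hx].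
have [y [Iy By]] : exists y, I y /\ ~ B n y.
  by apply: contrapT => h; apply: IBn => y Iy; apply: contrapT => By; apply: h; exists y.
have unitP c (A : set R) : is_ideal A -> ~ m c -> A (c * y) -> A y.
  move=> iA /(unit_outside_max nR mloc)[d cd] Acy.
  by rewrite -(mul1r y) -cd [c * d]mulrC -mulrA; exact: idealM.
have [|c hc] := @residue_pigeonhole n.+1
    (fun i => if (i < n)%N then [set c | B i (x + c * y)] else m).
  move=> i ni c c'; case: ltnP => ni'; last by exact: idealB.
  have [iB _] := hB i ni => /= h h'; apply: contrapT => mc.
  have Biy : B i y.
    apply: (unitP _ _ iB mc); rewrite mulrBl.
    have -> : c * y - c' * y = (x + c * y) - (x + c' * y) by ring.
    exact: idealB.
  apply: (hx i ni'); rewrite -(addrK (c * y) x).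
  by apply: idealB => //; exact: idealM.
exists (x + c * y); first by apply: idealD => //; exact: idealM.
move=> i; rewrite ltnS leq_eqVlt => /orP[/eqP ->|ni].
  have := hc n (leqnn _); rewrite ltnn => mc h; apply: By; apply: (unitP c) => //.
  by rewrite -(addKr x (c * y)) addrC; exact: idealB.
by have := hc i (leqW ni); rewrite ni.
Qed.

(** If [I v] lies in [E], so do all multiples of [v] of positive degree in [I]. *)
Lemma rees_torsion I J E r s v : rees_family I J E ->
  I `<=` colon (E r.+1 s) v -> forall i j k, product_ideal I J i.+1 j k ->
  E (i.+1 + r)%N (j + s)%N (k * v).
Proof.
move=> [iE _ mE] hI i j k hk'.
suff : product_ideal I J i.+1 j `<=` colon (E (i.+1 + r)%N (j + s)%N) v.
  by move=> /(_ _ hk'); rewrite /colon /= mulrC.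
apply: ideal_mul_sub => [|a b ha hb]; first exact: is_ideal_colon.
suff : ideal_exp I i.+1 `<=` colon (E (i.+1 + r)%N (j + s)%N) (v * b).
  by move=> /(_ _ ha); rewrite /colon /= -mulrA [b * a]mulrC.
apply: ideal_mul_sub => [|c d Ic hd]; first exact: is_ideal_colon.
rewrite /colon /=; have -> : v * b * (c * d) = (d * b) * (v * c) by ring.
by rewrite addSnnS; apply: mE; [exact: product_ideal_mem | exact: hI].
Qed.

(** Noetherian induction on [E]: enlarge [E] by the multiples of a homogeneous
    [v \in M \ E] for which [(E : v)] in degree [(1, 0)] is maximal.  If this
    ideal contains [I], the enlargement only matters in bounded degrees [r];
    otherwise elements [x] of [I] outside it are regular on the cyclic module
    generated by [v] modulo [E], as nonzero multiples of [v] are annihilated by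
    the same elements of [I] as [v], by maximality. *)
Lemma generic_filter_regular I J M E : is_ideal I -> is_ideal J ->
  rees_family I J M -> rees_family I J E -> (forall r s, E r s `<=` M r s) ->
  generic I (fun x => exists N, filter_regular M E x N).
Proof.
move=> iI iJ hM; move: E; apply: (rees_ind nR iI iJ) => E hE IH EM.
have [MP|] := pselect (exists t : nat * nat * R,
    M t.1.1 t.1.2 t.2 /\ ~ E t.1.1 t.1.2 t.2); last first.
  move=> no; apply: generic_true => x _; exists 0%N => r s v _ Mv _.
  by apply: contrapT => Ev; apply: no; exists (r, s, v).
have [iM sM cM] := hM; have [iE sE cE] := hE.
have [[[r s] v] /= [Mv Ev] maxv] := @maximal_member R nR (nat * nat * R)
  [set t | M t.1.1 t.1.2 t.2 /\ ~ E t.1.1 t.1.2 t.2]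
  (fun t => colon (E t.1.1.+1 t.1.2) t.2)
  (fun t _ => is_ideal_colon t.2 (iE t.1.1.+1 t.1.2)) MP.
(* Outside the quadrant of [(r, s)] the multiples of [v] contribute nothing. *)
pose K i j : set R := if (r <= i)%N && (s <= j)%N then
  product_ideal I J (i - r) (j - s) else [set 0].
have iK i j : is_ideal (K i j).
  rewrite /K; case: ifP => _; first exact: is_ideal_product.
  by split=> [//|a b /= -> ->|a b /= ->]; rewrite ?addr0 ?mulr0.
have KE i j k : K i j k -> k = 0 \/
    [/\ (r <= i)%N, (s <= j)%N & product_ideal I J (i - r) (j - s) k].
  by rewrite /K; case: ifP => [/andP[ri sj] h|_ ->]; [right | left].
pose E' i j := idsum (E i j) (idscale v (K i j)).
have KM i j k : K i j k -> M i j (v * k).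
  move=> /KE[->|[ri sj hk']]; first by rewrite mulr0; exact: ideal0.
  by rewrite mulrC -(subnK ri) -(subnK sj); exact: cM.
have E'M i j : E' i j `<=` M i j.
  by apply: sum_sub => //; apply: scale_sub => k; exact: KM.
have hE' : rees_family I J E'.
  split=> [i j|i j|i j a b c _ hc [e [_ [Ee [k hk' <-] ->]]]].
  - by apply: is_ideal_sum => //; exact: is_ideal_scale.
  - exact: subset_trans (sM i j).
  - exists (c * e), (v * (c * k)); split; [exact: cE | | by ring].
    exists (c * k) => //; case: (KE _ _ _ hk') => [->|[ri sj hk'']].
      by rewrite mulr0; exact: ideal0.
    rewrite /K (leq_trans ri (leq_addl _ _)) (leq_trans sj (leq_addl _ _)) /=.
    by rewrite -!addnBA //; exact: product_ideal_mul.
have vE' : E' r s v.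
  apply: sub_sumR => //; exists 1; rewrite ?mulr1 //.
  by rewrite /K !leqnn !subnn product_ideal00.
have gE' := IH E' hE' (fun i j => sub_sumL (is_ideal_scale v (iK i j)) (A := E i j))
  (ex_intro _ r (ex_intro _ s (fun h => Ev (h _ vE')))) E'M.
have [hI|hI] := pselect (I `<=` colon (E r.+1 s) v).
  apply: generic_imp gE' => x Ix [N fN]; exists (maxn N r.+1) => i j u.
  rewrite geq_max => /andP[Ni ri] Mu Exu.
  have [e [_ [Ee [k hk' <-] ->]]] : E' i j u.
    apply: (fN i j u Ni Mu); apply: sub_sumL => //.
    exact: is_ideal_scale.
  apply: idealD => //; case: (KE _ _ _ hk') => [->|[_ sj]].
    by rewrite mulr0; exact: ideal0.
  rewrite mulrC -{2}(subnK (ltnW ri)) -{2}(subnK sj).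
  rewrite -(prednK (n := i - r)) ?subn_gt0 //.
  exact: (rees_torsion hE hI).
apply: generic_imp (generic_and (generic_avoid (is_ideal_colon v (iE r.+1 s)) hI) gE').
move=> x Ix [Bx [N fN]]; exists N => i j u Ni Mu Exu.
have [e [_ [Ee [k hk' <-] Eu]]] : E' i j u.
  apply: (fN i j u Ni Mu); apply: sub_sumL => //.
  exact: is_ideal_scale.
rewrite Eu; apply: idealD => //; apply: contrapT => Evk.
apply: Bx; apply: (maxv (i, j, v * k)) => /=.
- by split=> //; exact: KM.
- move=> y; rewrite /colon /= => Evy.
  case: (KE _ _ _ hk') => [k0|[ri sj hk'']].
    by case: Evk; rewrite k0 mulr0; exact: ideal0.
  have -> : v * k * y = k * (v * y) by ring.
  by rewrite -(subnK ri) -addnS -{1}(subnK sj); exact: cE.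
- rewrite /colon /=; have -> : v * k * x = x * u - x * e by rewrite Eu; ring.
  apply: idealB => //; have := cE i j 1%N 0%N x e; rewrite add1n add0n; apply=> //.
  exact: product_ideal10.
Qed.

End Generic.
Definition max_multiple (R : comNzRingType) (m : set R)
    (M : nat -> nat -> set R) (r s : nat) : set R := ideal_mul m (M r s).

(** The bigraded submodule [E + x M] of [M], for [x] of degree [(1, 0)]. *)
Definition add_multiple (R : comNzRingType) (x : R)
    (M E : nat -> nat -> set R) (r s : nat) : set R :=
  if r is r'.+1 then idsum (idscale x (M r' s)) (E r s) else E r s.

(** For [E] contained in [M], the length of [M / E] in degree [(r, s)]. *)
Definition gap (R : comNzRingType) (M E : nat -> nat -> set R) (r s : nat) : nat :=
  length_quot (E r s) - length_quot (M r s).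

Section Reductions.
Variables (R : comNzRingType) (m : set R).
Hypothesis hloc : noetherian_local m.
Hypothesis hk : infinite_set (residue_ring m).
Implicit Types (A B I J K L : set R) (M E : nat -> nat -> set R) (x y z w v c : R).

Let nR : noetherian R. Proof. by case: hloc. Qed.
Let mm : maximal_ideal m. Proof. by case: hloc. Qed.
Let mloc : forall M : set R, maximal_ideal M -> M = m. Proof. by case: hloc. Qed.
Let im : is_ideal m. Proof. by case: mm. Qed.

Lemma rees_max_multiple I J M : rees_family I J M ->
  rees_family I J (max_multiple m M).
Proof.
move=> [iM sM cM]; split=> [r s|r s|r s i j c x hc].
- exact: is_ideal_mul.
- by apply: subset_trans (sM r s); exact: ideal_mul_subr.
have h : max_multiple m M r s `<=` colon (max_multiple m M (i + r) (j + s)) c.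
  apply: ideal_mul_sub; first exact/is_ideal_colon/is_ideal_mul.
  move=> a b ma Mb; rewrite /colon /= mulrCA; apply: ideal_mul_mem => //.
  exact: cM.
by move=> /h.
Qed.

Lemma max_multiple_sub M r s : is_ideal (M r s) -> max_multiple m M r s `<=` M r s.
Proof. exact: ideal_mul_subr. Qed.

Lemma add_multiple_sub I J M E x : rees_family I J M -> I x ->
  (forall r s, E r s `<=` M r s) -> forall r s, add_multiple x M E r s `<=` M r s.
Proof.
move=> [iM _ cM] Ix EM [|r] s; first exact: EM.
apply: sum_sub => //; apply: scale_sub => a Ma.
by have := cM r s 1%N 0%N x a; apply=> //; exact: product_ideal10.
Qed.

Lemma add_multiple_supp M E x r s : (forall r s, is_ideal (M r s)) ->
  E r s `<=` add_multiple x M E r s.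
Proof. by move=> iM; case: r => [|r] // a; apply: sub_sumR; exact: is_ideal_scale. Qed.

Lemma rees_add_multiple I J M E x : rees_family I J M -> rees_family I J E -> I x ->
  (forall r s, E r s `<=` M r s) -> rees_family I J (add_multiple x M E).
Proof.
move=> hM [iE sE cE] Ix EM; have [iM sM cM] := hM; split.
- by case=> [|r] s //=; apply: is_ideal_sum => //; exact: is_ideal_scale.
- by move=> r s; apply: subset_trans (sM r s); exact: add_multiple_sub.
case=> [|r] s i j c a hc /=.
  by move=> Ea; apply: add_multiple_supp => //; exact: cE.
move=> [_ [b [[u Mu <-] Eb ->]]]; rewrite addnS /= -addnS.
exists (x * (c * u)), (c * b); split; [|exact: cE| by ring].
by exists (c * u) => //; exact: cM.
Qed.

(** Where multiplication by [x] is injective on [M / E], the lengths of [M / E]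
    in consecutive degrees differ by that of [M / (E + x M)]. *)
Lemma gap_add_multiple I J M E x N r s : rees_family I J M -> rees_family I J E ->
  (forall r s, E r s `<=` M r s) -> (forall r s, finite_length (E r s)) ->
  I x -> filter_regular M E x N -> (N <= r)%N ->
  gap M E r.+1 s = (gap M E r s + gap M (add_multiple x M E) r.+1 s)%N.
Proof.
move=> hM hE EM fE Ix fx Nr; have [iM sM cM] := hM; have [iE sE cE] := hE.
have fM i j : finite_length (M i j) by exact: finite_length_sub (fE i j).
have := len_scale x (iM r s) (iE r.+1 s) (fM r s) (fE r.+1 s).
have -> : M r s `&` colon (E r.+1 s) x = E r s.
  apply/seteqP; split=> a; first by move=> [Ma Ea]; exact: fx Nr Ma Ea.
  move=> Ea; split; first exact: EM.
  by have := cE r s 1%N 0%N x a; apply=> //; exact: product_ideal10.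
rewrite -[idsum _ _]/(add_multiple x M E r.+1 s).
have iA := rees_add_multiple hM hE Ix EM.
have := len_sub (iE r s) (iM r s) (EM r s) (fE r s).
have := len_sub (iE r.+1 s) (iM r.+1 s) (EM r.+1 s) (fE r.+1 s).
have fA : finite_length (add_multiple x M E r.+1 s).
  apply: finite_length_sub (fE r.+1 s) => //; first by case: iA.
  exact: add_multiple_supp.
have iA' : is_ideal (add_multiple x M E r.+1 s) by case: iA.
have := len_sub iA' (iM r.+1 s) (add_multiple_sub hM Ix EM (s := s)) fA.
rewrite /gap; lia.
Qed.

Lemma gap_positive M E r s : is_ideal (E r s) -> is_ideal (M r s) ->
  E r s `<=` M r s -> finite_length (E r s) -> ~ M r s `<=` E r s ->
  (0 < gap M E r s)%N.
Proof.
by move=> iE iM EM fE ME; rewrite subn_gt0; apply: len_lt.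
Qed.

(** The increments of the length of [M / E] are the lengths of [M / (E + x M)]. *)
Lemma gap_growth I J M E x N s : rees_family I J M -> rees_family I J E ->
  (forall r s, E r s `<=` M r s) -> (forall r s, finite_length (E r s)) ->
  I x -> filter_regular M E x N ->
  (forall r, (N <= r)%N -> ~ M r.+1 s `<=` add_multiple x M E r.+1 s) ->
  forall k, (k <= gap M E (N + k) s)%N.
Proof.
move=> hM hE EM fE Ix fx no; elim=> // k IH.
have Nk : (N <= N + k)%N by exact: leq_addr.
rewrite addnS (gap_add_multiple s hM hE EM fE Ix fx Nk) -addn1.
have [iM _ _] := hM; have [iA _ _] := rees_add_multiple hM hE Ix EM.
apply: leq_add => //; apply: gap_positive => //; last exact: no.
  exact: add_multiple_sub hM Ix EM _ _.
apply: finite_length_sub (fE (N + k).+1 s) => //; first by case: hE.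
exact: add_multiple_supp.
Qed.

Lemma gap_growth_swap I J M E z N r : rees_family I J M -> rees_family I J E ->
  (forall r s, E r s `<=` M r s) -> (forall r s, finite_length (E r s)) -> J z ->
  filter_regular (fun s r => M r s) (fun s r => E r s) z N ->
  (forall s, (N <= s)%N -> ~ M r s.+1 `<=` idsum (idscale z (M r s)) (E r s.+1)) ->
  forall k, (k <= gap M E r (N + k))%N.
Proof.
move=> hM hE EM fE Jz fz no k.
exact: (@gap_growth J I (fun s r => M r s) (fun s r => E r s) z N r (rees_swap hM)
  (rees_swap hE) (fun r s => EM s r) (fun r s => fE s r) Jz fz no k).
Qed.

Variables (I J : set R) (M : nat -> nat -> set R).
Hypotheses (iI : is_ideal I) (iJ : is_ideal J).
Hypothesis hM : rees_family I J M.
Hypothesis fM : forall r s, finite_length (M r s).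

Let iM r s : is_ideal (M r s). Proof. by case: hM. Qed.
Let E0 := max_multiple m M.
Let hE0 : rees_family I J E0. Proof. exact: rees_max_multiple. Qed.
Let E0M r s : E0 r s `<=` M r s. Proof. exact: max_multiple_sub. Qed.
Let fE0 r s : finite_length (E0 r s).
Proof. by apply: (finite_length_mul hloc) => //; exact: (finite_length_max hloc). Qed.

Lemma nakayama_family A r s : is_ideal A -> M r s `<=` idsum A (E0 r s) ->
  M r s `<=` A.
Proof. by move=> iA; exact: (nakayama nR mm mloc). Qed.

Lemma generic_reduction_bounded C : (forall r, (gap M E0 r 0 <= C)%N) ->
  generic I (fun x => exists r, M r.+1 0 `<=` idscale x (M r 0)).
Proof.
move=> bC.
apply: generic_imp (generic_filter_regular hloc iI iJ hM hE0 E0M) => x Ix [N fx].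
apply: contrapT => no.
have g : forall k, (k <= gap M E0 (N + k) 0)%N.
  apply: gap_growth hM hE0 E0M fE0 Ix fx _ => r _ h; apply: no.
  by exists r; apply: nakayama_family; [exact: is_ideal_scale | exact: h].
by have := leq_trans (g C.+1) (bC _); rewrite ltnn.
Qed.

(** If [x] and [y] were not to reduce [M], the length of [M / m M] would grow
    quadratically: the gap of [M / (m M + x M)] would grow linearly, and it is
    the increment of the gap of [M / m M]. *)
Lemma generic_joint_reduction C : (forall r s, (gap M E0 r s <= C * (r + s).+1)%N) ->
  exists x, [/\ I x,
    generic I (fun y => exists r s,
      M r.+1 s `<=` idsum (idscale x (M r s)) (idscale y (M r s)))
  & generic J (fun z => exists r s,
      M r.+1 s.+1 `<=` idsum (idscale x (M r s.+1)) (idscale z (M r.+1 s)))].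
Proof.
move=> bC.
have [x Ix [N fx]] := generic_ex hloc hk iI
  (generic_filter_regular hloc iI iJ hM hE0 E0M).
pose E1 := add_multiple x M E0.
have hE1 : rees_family I J E1 by exact: rees_add_multiple.
have E1M r s : E1 r s `<=` M r s by exact: add_multiple_sub hM Ix E0M _ _.
have iE1 r s : is_ideal (E1 r s) by case: hE1.
have fE1 r s : finite_length (E1 r s).
  apply: finite_length_sub (fE0 r s) => //; first by case: hE0.
  exact: add_multiple_supp.
have step r s : (N <= r)%N -> gap M E0 r.+1 s = (gap M E0 r s + gap M E1 r.+1 s)%N.
  exact: gap_add_multiple hM hE0 E0M fE0 Ix fx.
have combine r s K z : is_ideal K ->
    M r.+1 s `<=` idsum (idscale z K) (E1 r.+1 s) ->
    M r.+1 s `<=` idsum (idscale x (M r s)) (idscale z K).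
  move=> iK h; apply: nakayama_family; first exact: is_ideal_combine.
  move=> a /h[b [_ [zb [c [d [xc Ed ->]]] ->]]].
  by exists (c + b), d; split=> //; [exists c, b | ring].
exists x; split=> //.
- apply: generic_imp (generic_filter_regular hloc iI iJ hM hE1 E1M) => y Iy [N' fy].
  apply: contrapT => no.
  pose L := maxn N N'.
  have fy' : filter_regular M E1 y L.
    by move=> r s v; rewrite geq_max => /andP[_]; exact: fy.
  have g1 : forall k, (k <= gap M E1 (L + k) 0)%N.
    apply: gap_growth hM hE1 E1M fE1 Iy fy' _ => r _ h; apply: no.
    by exists r, 0%N; exact: combine.
  have g0 k : (k * k.+1 <= 2 * gap M E0 (L + k) 0)%N.
    elim: k => // k IH; rewrite addnS step; last exact: leq_trans (leq_maxl N N') (leq_addr _ _).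
    by have := g1 k.+1; rewrite addnS; nia.
  (* Any [k] with [k (k + 1) > 2 C (L + k + 1)] will do. *)
  have := g0 (2 * C * (L + 2) + 1)%N; have := bC (L + (2 * C * (L + 2) + 1))%N 0%N.
  by clear; nia.
- have := generic_filter_regular hloc iJ iI (rees_swap hM) (rees_swap hE1)
    (fun r s => E1M s r).
  apply: generic_imp => z Jz [N' fz].
  apply: contrapT => no.
  have g1 r : forall k, (k <= gap M E1 r.+1 (N' + k))%N.
    apply: gap_growth_swap hM hE1 E1M fE1 Jz fz _ => s _ h; apply: no.
    by exists r, s; exact: combine.
  have g0 j k : (j * k <= gap M E0 (N + j) (N' + k))%N.
    elim: j => // j IH; rewrite addnS step ?leq_addr //.
    by have := g1 (N + j)%N k; nia.
  (* Any [k] with [k^2 > C (N + N' + 2 k + 1)] will do. *)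
  pose k := (C * (N + N' + 3) + 1)%N.
  have := g0 k k; have := bC (N + k)%N (N' + k)%N.
  by rewrite /k; clear; nia.
Qed.

Hypothesis stepI : forall r s, M r.+1 s `<=` ideal_mul I (M r s).
Hypothesis stepJ : forall r s, M r s.+1 `<=` ideal_mul J (M r s).

Let mulI r s a b : I a -> M r s b -> M r.+1 s (a * b).
Proof. by move=> Ia Mb; have [_ _ cM] := hM; rewrite -[r.+1]add1n -[s]add0n; apply: cM => //; exact: product_ideal10. Qed.

Let mulJ r s a b : J a -> M r s b -> M r s.+1 (a * b).
Proof. by move=> Ja Mb; have [_ _ cM] := hM; rewrite -[s.+1]add1n -[r]add0n; apply: cM => //; exact: product_ideal01. Qed.

Lemma combine_mul A x z K L K' L' D : is_ideal K' -> is_ideal L' ->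
  (forall a k, A a -> K k -> K' (a * k)) -> (forall a k, A a -> L k -> L' (a * k)) ->
  D `<=` idsum (idscale x K) (idscale z L) ->
  ideal_mul A D `<=` idsum (idscale x K') (idscale z L').
Proof.
move=> iK' iL' hK hL h; apply: ideal_mul_sub; first exact: is_ideal_combine.
move=> a d Aa /h[_ [_ [[k Kk <-] [l Ll <-] ->]]].
exists (x * (a * k)), (z * (a * l)); split; last by ring.
  by exists (a * k) => //; exact: hK.
by exists (a * l) => //; exact: hL.
Qed.

Lemma eventually_all (P : nat -> nat -> Prop) r0 s0 : P r0 s0 ->
  (forall r s, P r s -> P r.+1 s) -> (forall r s, P r s -> P r s.+1) ->
  forall r s, (r0 <= r)%N -> (s0 <= s)%N -> P r s.
Proof.
move=> P0 Pr Ps r s rr ss; rewrite -(subnK rr) -(subnK ss).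
elim: (r - r0)%N => [|k IH]; last exact: Pr.
elim: (s - s0)%N => [|k IH]; last exact: Ps.
exact: P0.
Qed.

Lemma reduction_same x y r0 s0 :
  M r0.+1 s0 `<=` idsum (idscale x (M r0 s0)) (idscale y (M r0 s0)) ->
  forall r s, (r0 <= r)%N -> (s0 <= s)%N ->
    M r.+1 s `<=` idsum (idscale x (M r s)) (idscale y (M r s)).
Proof.
move=> h0; apply: (eventually_all (P := fun r s =>
  M r.+1 s `<=` idsum (idscale x (M r s)) (idscale y (M r s)))) => // r s /= h.
  apply: subset_trans (@stepI r.+1 s) _.
  by apply: combine_mul h => // a k; exact: mulI.
apply: subset_trans (@stepJ r.+1 s) _.
by apply: combine_mul h => // a k; exact: mulJ.
Qed.

Lemma reduction_mixed x z r0 s0 :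
  M r0.+1 s0.+1 `<=` idsum (idscale x (M r0 s0.+1)) (idscale z (M r0.+1 s0)) ->
  forall r s, (r0 <= r)%N -> (s0 <= s)%N ->
    M r.+1 s.+1 `<=` idsum (idscale x (M r s.+1)) (idscale z (M r.+1 s)).
Proof.
move=> h0; apply: (eventually_all (P := fun r s =>
  M r.+1 s.+1 `<=` idsum (idscale x (M r s.+1)) (idscale z (M r.+1 s)))) => // r s /= h.
  apply: subset_trans (@stepI r.+1 s.+1) _.
  by apply: combine_mul h => // a k; exact: mulI.
apply: subset_trans (@stepJ r.+1 s.+1) _.
by apply: combine_mul h => // a k; exact: mulJ.
Qed.

End Reductions.
Section JointReductions.
Variables (R : comNzRingType) (m : set R).
Hypothesis hloc : noetherian_local m.
Hypothesis hk : infinite_set (residue_ring m).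
Variables (I J : set R) (M : nat -> nat -> set R).
Hypotheses (iI : is_ideal I) (iJ : is_ideal J).
Hypothesis hM : rees_family I J M.
Hypothesis fM : forall r s, finite_length (M r s).
Hypothesis stepI : forall r s, M r.+1 s `<=` ideal_mul I (M r s).
Hypothesis stepJ : forall r s, M r s.+1 `<=` ideal_mul J (M r s).

Let stepI' r s : M s r.+1 `<=` ideal_mul J (M s r). Proof. exact: stepJ. Qed.
Let stepJ' r s : M s.+1 r `<=` ideal_mul I (M s r). Proof. exact: stepI. Qed.

(** Two joint reductions of type [(1, 1)], [(x, z)] and [(w, y)], such that
    [(x, y)] and [(w, z)] are reductions of [I] and [J]: as the conditions on
    [y] and [z] given [x] and [w] are generic, they can be met together. *)
Theorem joint_reductions C :
  (forall r s, (gap M (max_multiple m M) r s <= C * (r + s).+1)%N) ->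
  exists x y z w N, [/\ I x, I y, J z & J w] /\
    forall r s, (N <= r)%N -> (N <= s)%N ->
    [/\ M r.+1 s `<=` idsum (idscale x (M r s)) (idscale y (M r s)),
        M r.+1 s.+1 `<=` idsum (idscale x (M r s.+1)) (idscale z (M r.+1 s)),
        M r.+1 s.+1 `<=` idsum (idscale w (M r.+1 s)) (idscale y (M r s.+1))
      & M r s.+1 `<=` idsum (idscale w (M r s)) (idscale z (M r s))].
Proof.
move=> bC; have hM' := rees_swap hM.
have [x [Ix gy gz]] := generic_joint_reduction hloc hk iI iJ hM fM bC.
have [w [Jw gz' gy']] := @generic_joint_reduction _ _ hloc hk J I
  (fun r s => M s r) iJ iI hM' (fun r s => fM s r) C
  (fun r s => eq_ind (s + r)%N (fun t => is_true (gap M (max_multiple m M) s r <= C * t.+1)%N)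
     (bC s r) _ (addnC s r)).
have [y Iy [[r1 [s1 h1]] [r2 [s2 h2]]]] := generic_ex hloc hk iI (generic_and gy gy').
have [z Jz [[r3 [s3 h3]] [r4 [s4 h4]]]] := generic_ex hloc hk iJ (generic_and gz gz').
exists x, y, z, w, (r1 + s1 + r2 + s2 + (r3 + s3 + r4 + s4))%N; split=> // r s Nr Ns; split.
- by apply: (reduction_same hM stepI stepJ h1); lia.
- by apply: (reduction_mixed hM stepI stepJ h3); lia.
- by apply: (@reduction_mixed _ J I _ hM' stepI' stepJ' _ _ _ _ h2 s r); lia.
- by apply: (@reduction_same _ J I _ hM' stepI' stepJ' _ _ _ _ h4 s r); lia.
Qed.

End JointReductions.

(** * Admissible filtrations *)

Section Filtration.
Variables (R : comNzRingType) (I J : set R) (F : int * int -> set R).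
Hypothesis hF : admissible_filtration I J F.

Lemma finite_set_bounded (A : set (int * int)) : finite_set A ->
  exists N : nat, forall n, A n -> n.1 <= N%:Z /\ n.2 <= N%:Z.
Proof.
move=> /finite_seqP[s ->]; elim: s => [|a s [N hN]]; first by exists 0%N.
exists (N + `|a.1| + `|a.2|)%N => n /=.
rewrite inE => /orP[/eqP ->|/hN]; first by split; lia.
by move=> []; lia.
Qed.

Lemma filtration_ideal n : is_ideal (F n). Proof. by case: hF => h _. Qed.

(** Here [N] bounds the degrees of finitely many generators of the filtration over
    the Rees algebra; components of degree [n] of their multiples are sums of
    products [c g] as in the hypothesis. *)
Lemma filtration_generation : exists N : nat, forall n (X : set R), is_ideal X ->
  (forall k p, p.1 <= N%:Z -> p.2 <= N%:Z -> k + p = n ->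
     forall c g, product_powers I J k c -> F p g -> X (c * g)) ->
  F n `<=` X.
Proof.
case: hF => _ [_ _ _ _ [k [g [Mg gen]]]].
have [N hN] : exists N : nat, forall i n, g i n != 0 -> n.1 <= N%:Z /\ n.2 <= N%:Z.
  have hb i : exists N : nat, forall n, g i n != 0 -> n.1 <= N%:Z /\ n.2 <= N%:Z.
    by have [/finite_set_bounded] := Mg i.
  pose B i := sval (cid (hb i)); exists (\max_i B i)%N => i n gin.
  have hB := svalP (cid (hb i)) n gin.
  have := leq_bigmax (F := B) i; rewrite /B in hB *; case: hB; lia.
exists N => n X iX hX v Fv.
pose f p := if p == n then v else 0.
have [|c [hc fE]] := gen f.
  split; last by move=> p; rewrite /f; case: eqP => [-> //|_]; apply: ideal0; exact: filtration_ideal.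
  apply: (@sub_finite_set _ _ [set n]); last exact: finite_set1.
  by by move=> p; rewrite /f /=; case: (eqVneq p n) => [->|_] //; rewrite eqxx.
have -> : v = f n by rewrite /f eqxx.
rewrite fE; apply: ideal_sum => // i _; apply: ideal_sum => // p _.
have [->|gne] := eqVneq (g i (n - p)) 0; first by rewrite mulr0; exact: ideal0.
have [N1 N2] := hN _ _ gne.
apply: (hX p (n - p)) => //; first by rewrite addrC subrK.
  by have [_] := hc i; exact.
by have [_] := Mg i; exact.
Qed.

Definition nat_filtration (r s : nat) : set R := F (r%:Z, s%:Z).

Local Notation G := nat_filtration.

Lemma nat_filtration_ideal r s : is_ideal (G r s).
Proof. exact: filtration_ideal. Qed.

Lemma product_sub_filtration r s : product_ideal I J r s `<=` G r s.
Proof. by case: hF => _ [h _ _ _ _]; exact: (h (r%:Z, s%:Z)). Qed.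

Lemma filtration_mul r s i j a b : G r s a -> G i j b -> G (r + i) (s + j) (a * b).
Proof.
move=> ha hb; case: hF => _ [_ h _ _ _].
have := h (r%:Z, s%:Z) (i%:Z, j%:Z) (a * b); rewrite /G !PoszD; apply.
exact: ideal_mul_mem.
Qed.

Lemma product_mul_filtration r s i j a b :
  product_ideal I J r s a -> G i j b -> G (r + i) (s + j) (a * b).
Proof. by move=> /product_sub_filtration; exact: filtration_mul. Qed.

Lemma filtration00 : G 0 0 = setT.
Proof.
by apply/seteqP; split=> // x _; apply: product_sub_filtration; rewrite product_ideal00.
Qed.

Lemma filtration_step : exists N : nat, forall r s : nat,
  ((N <= r)%N -> G r.+1 s `<=` ideal_mul I (G r s)) /\
  ((N <= s)%N -> G r s.+1 `<=` ideal_mul J (G r s)).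
Proof.
case: hF => _ [hP hM _ _ _].
have [N hN] := filtration_generation; exists N => r s.
have mulF n p a b : F n a -> F p b -> F (n + p) (a * b).
  by move=> ha hb; apply: (hM n p); exact: ideal_mul_mem.
split=> h; apply: hN => [|[k l] [p q] /= Np Nq [E1 E2] c g hc hg];
  try exact: is_ideal_mul.
- have [j Ej] : exists j : nat, k = j.+1%:Z.
    by exists (`|k|.-1)%N; lia.
  suff : product_powers I J (k, l) `<=` colon (ideal_mul I (G r s)) g.
    by move=> /(_ _ hc); rewrite /colon /= mulrC.
  apply: ideal_mul_sub => [|a b ha hb]; first exact/is_ideal_colon/is_ideal_mul.
  suff : ideal_exp I j.+1 `<=` colon (ideal_mul I (G r s)) (g * b).
    by move: ha; rewrite Ej /= => ha /(_ _ ha); rewrite /colon /= -mulrA [b * a]mulrC.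
  apply: ideal_mul_sub => [|a1 a2 h1 h2]; first exact/is_ideal_colon/is_ideal_mul.
  rewrite /colon /=; have -> : g * b * (a1 * a2) = a1 * (a2 * b * g) by ring.
  apply: ideal_mul_mem => //.
  have -> : G r s = F ((j%:Z, l) + (p, q)).
    rewrite /G; congr F; rewrite -[RHS]/(j%:Z + p, l + q); congr (_, _); lia.
  by apply: mulF => //; apply: hP; exact: ideal_mul_mem.
- have [j Ej] : exists j : nat, l = j.+1%:Z.
    by exists (`|l|.-1)%N; lia.
  suff : product_powers I J (k, l) `<=` colon (ideal_mul J (G r s)) g.
    by move=> /(_ _ hc); rewrite /colon /= mulrC.
  apply: ideal_mul_sub => [|a b ha hb]; first exact/is_ideal_colon/is_ideal_mul.
  suff : ideal_exp J j.+1 `<=` colon (ideal_mul J (G r s)) (g * a).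
    by move: hb; rewrite Ej /= => hb /(_ _ hb); rewrite /colon /= -mulrA.
  apply: ideal_mul_sub => [|b1 b2 h1 h2]; first exact/is_ideal_colon/is_ideal_mul.
  rewrite /colon /=; have -> : g * a * (b1 * b2) = b1 * (a * b2 * g) by ring.
  apply: ideal_mul_mem => //.
  have -> : G r s = F ((k, j%:Z) + (p, q)).
    rewrite /G; congr F; rewrite -[RHS]/(k + p, j%:Z + q); congr (_, _); lia.
  by apply: mulF => //; apply: hP; exact: ideal_mul_mem.
Qed.

(** Shifting by a large [N] makes the filtration stable from degree [(0, 0)] on, so
    that its members become the components of a homogeneous ideal of the Rees
    algebra. *)
Definition tail (N r s : nat) : set R := G (r + N) (s + N).

Lemma rees_tail N :
  (forall r s, tail N r.+1 s `<=` ideal_mul I (tail N r s)) ->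
  (forall r s, tail N r s.+1 `<=` ideal_mul J (tail N r s)) ->
  rees_family I J (tail N).
Proof.
move=> hI hJ; split=> [r s|r s|r s i j c x hc hx].
- exact: nat_filtration_ideal.
- elim: r => [|r IH].
    elim: s => [|s IH]; first by rewrite product_ideal00.
    apply: subset_trans (hJ 0%N s) _; apply: ideal_mul_sub; first exact: is_ideal_product.
    move=> a b Ja /IH hb.
    by have := product_ideal_mul (product_ideal01 (I := I) Ja) hb; rewrite add0n add1n.
  apply: subset_trans (hI r s) _; apply: ideal_mul_sub; first exact: is_ideal_product.
  move=> a b Ia /IH hb.
  by have := product_ideal_mul (product_ideal10 (J := J) Ia) hb; rewrite add0n add1n.
- by rewrite /tail -!addnA; exact: product_mul_filtration.
Qed.

End Filtration.
(** * Hilbert polynomials and the equality case *)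

Lemma hilbert_poly1 e r s :
  hilbert_poly 1 e r s = e 1%N 0%N * r%:Z + e 0%N 1%N * s%:Z - e 0%N 0%N.
Proof.
rewrite /hilbert_poly; under eq_bigr do rewrite big_mkcond.
rewrite !big_ord_recl !big_ord0 /= /bump /= ?addn0 ?addn1 ?subn0 ?subn1 ?bin0 ?bin1.
by rewrite !expr0 !expr1 /=; ring.
Qed.

Lemma hilbert_poly2 e r s :
  hilbert_poly 2 e r s = e 2%N 0%N * 'C(r.+1, 2)%:Z + e 1%N 1%N * (r%:Z * s%:Z)
    + e 0%N 2%N * 'C(s.+1, 2)%:Z - e 1%N 0%N * r%:Z - e 0%N 1%N * s%:Z + e 0%N 0%N.
Proof.
have E2 n : (n + 2 - 1 = n.+1)%N by lia.
have E1 n : (n + 1 - 1 = n)%N by lia.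
rewrite /hilbert_poly; under eq_bigr do rewrite big_mkcond.
rewrite !big_ord_recl !big_ord0 /= /bump /= ?E2 ?E1 ?subn0 ?bin0 ?bin1.
by rewrite ?expr0 ?expr1 ?expr2 /=; ring.
Qed.

Lemma triangularS n : ('C(n.+2, 2) = 'C(n.+1, 2) + n.+1)%N.
Proof. by rewrite binS bin1. Qed.

Lemma triangular n : (2 * 'C(n.+1, 2) = n * n.+1)%N.
Proof. by elim: n => // n IH; rewrite binS mulnDr IH bin1; lia. Qed.

(** Every value of [D] lies between [D 0 0] and a value that is known to be 0. *)
Lemma defect_zero (D : nat -> nat -> int) N :
  (forall r s, D r s <= D r.+1 s) -> (forall r s, D r s <= D r s.+1) ->
  (forall r s, (N <= r)%N -> (N <= s)%N -> D r s = 0) -> 0 <= D 0%N 0%N ->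
  forall r s, D r s = 0.
Proof.
move=> mr ms D0 D00 r s.
have up i j k l : D i j <= D (k + i)%N (l + j)%N.
  elim: k => [|k IH]; last exact: le_trans IH (mr _ _).
  by elim: l => [|l IH] //; exact: le_trans IH (ms _ _).
apply/eqP; rewrite eq_le; apply/andP; split.
  by rewrite -(D0 (N + r)%N (N + s)%N) ?leq_addr.
by apply: le_trans D00 _; have := up 0%N 0%N r s; rewrite !addn0.
Qed.

Section Rigidity.
Variables (R : comNzRingType) (G : nat -> nat -> set R).
Hypothesis iG : forall r s, is_ideal (G r s).
Hypothesis fG : forall r s, finite_length (G r s).
Hypothesis mG : forall r s i j a b, G r s a -> G i j b -> G (r + i)%N (s + j)%N (a * b).
Hypothesis G00 : G 0%N 0%N = setT.

Local Notation H r s := (length_quot (G r s)).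

Lemma filtration_exp i j a n : G i j a -> G (n * i)%N (n * j)%N (a ^+ n).
Proof.
move=> ha; elim: n => [|n IH]; first by rewrite !mul0n G00.
by rewrite exprS !mulSn; exact: mG.
Qed.

Lemma filtration_monomial y z r s : G 1%N 0%N y -> G 0%N 1%N z ->
  G r s (y ^+ r * z ^+ s).
Proof.
move=> /(filtration_exp r) hy /(filtration_exp s) hz.
by have := mG hy hz; rewrite !muln1 !muln0 addn0.
Qed.

(** By [len_combine_le] the colength of [X] exceeds [H r s] by at most that of
    [(x, y^(r+1) z^s)], which is subadditive in the factors of the monomial. *)
Lemma filtration_increment x y z r s : G 1%N 0%N x -> G 1%N 0%N y -> G 0%N 1%N z ->
  finite_length (pair_ideal x y) -> finite_length (pair_ideal x z) ->
  let X := idsum (idscale x (G r s)) (principal (y ^+ r.+1 * z ^+ s)) in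
  [/\ is_ideal X, finite_length X, X `<=` G r.+1 s
    & (length_quot X <= H r s + (r.+1 * length_quot (pair_ideal x y)
                               + s * length_quot (pair_ideal x z)))%N].
Proof.
move=> Gx Gy Gz fxy fxz X.
rewrite pair_idealC in fxy; rewrite pair_idealC in fxz.
have [fb lb] := len_pair_monomial r.+1 s fxy fxz.
rewrite pair_idealC in fb lb.
have iX : is_ideal X by apply: is_ideal_combine => //; exact: is_ideal_setT.
have [fX lX] := len_combine_le (iG r s) (@is_ideal_setT R) fb (fG r s) (finite_length_setT R).
split=> //; last first.
  rewrite len_setT addn0 in lX; apply: leq_trans lX _; rewrite addnC leq_add2l.
  by rewrite [pair_ideal x y]pair_idealC [pair_ideal x z]pair_idealC.
apply: sum_sub => //; first by apply: scale_sub => a; exact: (mG Gx).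
by apply: principal_sub => //; exact: filtration_monomial.
Qed.

End Rigidity.

Section RigidityTwo.
Variables (R : comNzRingType) (G : nat -> nat -> set R).
Hypothesis iG : forall r s, is_ideal (G r s).
Hypothesis fG : forall r s, finite_length (G r s).
Hypothesis mG : forall r s i j a b, G r s a -> G i j b -> G (r + i)%N (s + j)%N (a * b).
Hypothesis G00 : G 0%N 0%N = setT.
Variables (x y z w : R) (a b c e : int) (N : nat).
Hypotheses (Gx : G 1%N 0%N x) (Gy : G 1%N 0%N y) (Gz : G 0%N 1%N z) (Gw : G 0%N 1%N w).
Hypotheses (fxy : finite_length (pair_ideal x y)) (fxz : finite_length (pair_ideal x z)).
Hypotheses (fwy : finite_length (pair_ideal w y)) (fwz : finite_length (pair_ideal w z)).
Hypotheses (lxy : (length_quot (pair_ideal x y))%:Z <= a)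
  (lxz : (length_quot (pair_ideal x z))%:Z <= b)
  (lwy : (length_quot (pair_ideal w y))%:Z <= b)
  (lwz : (length_quot (pair_ideal w z))%:Z <= c).

Let P (r s : nat) : int :=
  a * 'C(r.+1, 2)%:Z + b * (r%:Z * s%:Z) + c * 'C(s.+1, 2)%:Z + e.
Local Notation H r s := (length_quot (G r s)).
Let X r s := idsum (idscale x (G r s)) (principal (y ^+ r.+1 * z ^+ s)).
Let Y r s := idsum (idscale w (G r s)) (principal (z ^+ s.+1 * y ^+ r)).

Hypothesis HP : forall r s, (N <= r)%N -> (N <= s)%N -> P r s = (H r s)%:Z.

Let P_r r s : P r.+1 s = P r s + (a * r.+1%:Z + b * s%:Z).
Proof. by rewrite /P triangularS PoszD !intS; ring. Qed.

Let P_s r s : P r s.+1 = P r s + (c * s.+1%:Z + b * r%:Z).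
Proof. by rewrite /P (triangularS s) PoszD !intS; ring. Qed.

Let incr_r r s : [/\ is_ideal (X r s), finite_length (X r s), X r s `<=` G r.+1 s
  & (length_quot (X r s))%:Z <= (H r s)%:Z + (a * r.+1%:Z + b * s%:Z)].
Proof.
have [iX fX sX lX] := filtration_increment iG fG mG G00 r s Gx Gy Gz fxy fxz.
split=> //; rewrite -/(X r s) in lX.
have h1 := ler_wpM2r (isT : 0 <= r.+1%:Z) lxy.
have h2 := ler_wpM2r (isT : 0 <= s%:Z) lxz.
move: lX h1 h2; rewrite -!PoszM; lia.
Qed.

Let incr_s r s : [/\ is_ideal (Y r s), finite_length (Y r s), Y r s `<=` G r s.+1
  & (length_quot (Y r s))%:Z <= (H r s)%:Z + (c * s.+1%:Z + b * r%:Z)].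
Proof.
have [iY fY sY lY] := @filtration_increment R (fun s r => G r s) (fun s r => iG r s)
  (fun s r => fG r s) (fun r s i j a b => @mG s r j i a b) G00 w z y s r Gw Gz Gy fwz fwy.
split=> //; rewrite -/(Y r s) in lY.
have h1 := ler_wpM2r (isT : 0 <= s.+1%:Z) lwz.
have h2 := ler_wpM2r (isT : 0 <= r%:Z) lwy.
move: lY h1 h2; rewrite -!PoszM; lia.
Qed.

(** The values of [P] at [(2n, 2n)] and [(n, n)] satisfy
    [P(2n, 2n) - 2 P(n, n) = n^2 (a + 2 b + c) - e], whereas comparing
    [G(2n, 2n)] with [u G(n, n) + v G(n, n)] for [u = x^n w^n], [v = y^n z^n]
    bounds [H(2n, 2n) - 2 H(n, n)] by [l(u, v) <= n^2 (a + 2 b + c)]. *)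
Let constant_nonneg : 0 <= e.
Proof.
pose n := N; pose u := x ^+ n * w ^+ n; pose v := y ^+ n * z ^+ n.
have Gu : G n n u by exact: filtration_monomial.
have Gv : G n n v by exact: filtration_monomial.
have [fvx lvx] : finite_length (pair_ideal x v) /\
    (length_quot (pair_ideal x v) <= n * length_quot (pair_ideal x y)
       + n * length_quot (pair_ideal x z))%N.
  by rewrite ![pair_ideal x _]pair_idealC; apply: len_pair_monomial; rewrite pair_idealC.
have [fvw lvw] : finite_length (pair_ideal w v) /\
    (length_quot (pair_ideal w v) <= n * length_quot (pair_ideal w y)
       + n * length_quot (pair_ideal w z))%N.
  by rewrite ![pair_ideal w _]pair_idealC; apply: len_pair_monomial; rewrite pair_idealC.
have [fuv luv] := len_pair_monomial n n fvx fvw.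
have [fK lK] := len_combine_le (iG n n) (iG n n) fuv (fG n n) (fG n n).
have lG : (H (n + n) (n + n) <= length_quot (idsum (idscale u (G n n)) (idscale v (G n n))))%N.
  apply: len_sub => //; first exact: is_ideal_combine.
  by apply: sum_sub => //; apply: scale_sub => k; exact: mG.
have T2 : ('C((n + n).+1, 2) = 2 * 'C(n.+1, 2) + n * n)%N.
  by have := triangular (n + n); have := triangular n; nia.
have E1 : P (n + n) (n + n) = (H (n + n) (n + n))%:Z by apply: HP; rewrite leq_addr.
have E2 : P n n = (H n n)%:Z by apply: HP.
have nn2 : 0 <= n%:Z * n%:Z by rewrite -PoszM.
have h1 := ler_wpM2l nn2 lxy; have h2 := ler_wpM2l nn2 lxz.
have h3 := ler_wpM2l nn2 lwy; have h4 := ler_wpM2l nn2 lwz.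
have bound : (length_quot (pair_ideal u v) <= (n * n) * length_quot (pair_ideal x y)
   + (n * n) * length_quot (pair_ideal x z) + (n * n) * length_quot (pair_ideal w y)
   + (n * n) * length_quot (pair_ideal w z))%N.
  apply: leq_trans luv _.
  have := leq_mul (leqnn n) lvx; have := leq_mul (leqnn n) lvw.
  by rewrite !mulnDr !mulnA; lia.
have total : (H (n + n) (n + n))%:Z <=
    n%:Z * n%:Z * a + n%:Z * n%:Z * b + n%:Z * n%:Z * b + n%:Z * n%:Z * c
    + 2 * (H n n)%:Z.
  have := leq_trans lG (leq_trans lK (leq_add (leq_add bound (leqnn _)) (leqnn _))).
  rewrite -lez_nat !PoszD !PoszM; lia.
move: total; rewrite -E1 -E2 /P T2 !PoszD !PoszM.
by set t := Posz 'C(_, _); set k := Posz n; clear; lia.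
Qed.

Let defect r s : P r s = (H r s)%:Z.
Proof.
suff : P r s - (H r s)%:Z = 0 by lia.
apply: (defect_zero (D := fun r s => P r s - (H r s)%:Z) (N := N)) => [i j|i j|i j hi hj|].
- have [iX fX sX lX] := incr_r i j; have := len_sub iX (iG i.+1 j) sX fX.
  rewrite /= P_r; lia.
- have [iY fY sY lY] := incr_s i j; have := len_sub iY (iG i j.+1) sY fY.
  rewrite /= P_s; lia.
- by rewrite HP // subrr.
- by rewrite /= G00 len_setT subr0 /P /= !mulr0 !add0r; exact: constant_nonneg.
Qed.

Theorem rigidity_two : (forall r s, P r s = (H r s)%:Z) /\
  (forall r s, G r.+1 s = idsum (idscale x (G r s)) (principal (y ^+ r.+1 * z ^+ s))) /\
  (forall r s, G r s.+1 = idsum (idscale w (G r s)) (principal (z ^+ s.+1 * y ^+ r))).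
Proof.
split; first exact: defect; split=> r s; symmetry.
- have [iX fX sX lX] := incr_r r s; rewrite -/(X r s); apply: len_eq => //.
  by have := defect r.+1 s; rewrite P_r defect; lia.
- have [iY fY sY lY] := incr_s r s; rewrite -/(Y r s); apply: len_eq => //.
  by have := defect r s.+1; rewrite P_s defect; lia.
Qed.

End RigidityTwo.

Section RigidityOne.
Variables (R : comNzRingType) (G : nat -> nat -> set R).
Hypothesis iG : forall r s, is_ideal (G r s).
Hypothesis fG : forall r s, finite_length (G r s).
Hypothesis mG : forall r s i j a b, G r s a -> G i j b -> G (r + i)%N (s + j)%N (a * b).
Hypothesis G00 : G 0%N 0%N = setT.
Variables (x z : R) (a c : int) (N : nat).
Hypotheses (Gx : G 1%N 0%N x) (Gz : G 0%N 1%N z).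
Hypotheses (fx : finite_length (principal x)) (fz : finite_length (principal z)).
Hypotheses (lx : (length_quot (principal x))%:Z <= a) (lz : (length_quot (principal z))%:Z <= c).

Let P (r s : nat) : int := a * r%:Z + c * s%:Z.
Local Notation H r s := (length_quot (G r s)).

Hypothesis HP : forall r s, (N <= r)%N -> (N <= s)%N -> P r s = (H r s)%:Z.

Lemma scale_increment t r s : finite_length (principal t) ->
  [/\ is_ideal (idscale t (G r s)), finite_length (idscale t (G r s))
    & (length_quot (idscale t (G r s)) <= H r s + length_quot (principal t))%N].
Proof.
move=> ft; have iX := is_ideal_scale t (iG r s).
have [] // := @len_cover _ (G r s) (principal t) (idscale t (G r s)) t.
- exact: is_ideal_principal.
- by move=> u Gu; exists u.
- exact: sub_sumL.
Qed.

Let incr_x r s : idscale x (G r s) `<=` G r.+1 s.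
Proof. by apply: scale_sub => u; exact: (mG Gx). Qed.

Let incr_z r s : idscale z (G r s) `<=` G r s.+1.
Proof. by apply: scale_sub => u; exact: (mG Gz). Qed.

Theorem rigidity_one : (forall r s, P r s = (H r s)%:Z) /\
  (forall r s, G r.+1 s = idscale x (G r s)) /\
  (forall r s, G r s.+1 = idscale z (G r s)).
Proof.
have P_r r s : P r.+1 s = P r s + a by rewrite /P intS; ring.
have P_s r s : P r s.+1 = P r s + c by rewrite /P intS; ring.
have defect r s : P r s = (H r s)%:Z.
  suff : P r s - (H r s)%:Z = 0 by lia.
  apply: (defect_zero (D := fun r s => P r s - (H r s)%:Z) (N := N)) => [i j|i j|i j hi hj|].
  - have [iX fX lX] := scale_increment i j fx.
    have := len_sub iX (iG i.+1 j) (@incr_x i j) fX; rewrite /= P_r; lia.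
  - have [iY fY lY] := scale_increment i j fz.
    have := len_sub iY (iG i j.+1) (@incr_z i j) fY; rewrite /= P_s; lia.
  - by rewrite HP // subrr.
  - by rewrite /= G00 len_setT /P !mulr0.
split; first exact: defect; split=> r s; symmetry.
- have [iX fX lX] := scale_increment r s fx; apply: len_eq => //.
  by have := defect r.+1 s; rewrite P_r defect; lia.
- have [iY fY lY] := scale_increment r s fz; apply: len_eq => //.
  by have := defect r s.+1; rewrite P_s defect; lia.
Qed.

End RigidityOne.
(** * Assembling the equivalence *)

Lemma hilbert_poly1_diff e r s :
  (hilbert_poly 1 e r.+1 s - hilbert_poly 1 e r s = e 1%N 0%N) *
  (hilbert_poly 1 e r s.+1 - hilbert_poly 1 e r s = e 0%N 1%N).
Proof. by rewrite !hilbert_poly1 !intS; split; ring. Qed.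

Lemma hilbert_poly2_diff e r s :
  (hilbert_poly 2 e r.+1 s - hilbert_poly 2 e r s =
     e 2%N 0%N * r.+1%:Z + e 1%N 1%N * s%:Z - e 1%N 0%N) *
  (hilbert_poly 2 e r s.+1 - hilbert_poly 2 e r s =
     e 0%N 2%N * s.+1%:Z + e 1%N 1%N * r%:Z - e 0%N 1%N).
Proof. by rewrite !hilbert_poly2 !triangularS !PoszD !intS; split; ring. Qed.

Section Products.
Variable R : comNzRingType.
Implicit Types (I J K L D B : set R) (x y z : R).

Lemma ideal_mulT K : is_ideal K -> ideal_mul K setT = K.
Proof.
move=> iK; apply/seteqP; split; first exact: ideal_mul_subl.
by move=> a Ka; rewrite -(mulr1 a); exact: ideal_mul_mem.
Qed.

Lemma ideal_expS1 I : is_ideal I -> ideal_exp I 1 = I.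
Proof. exact: ideal_mulT. Qed.

Lemma ideal_mul_pair x y K : is_ideal K ->
  ideal_mul (pair_ideal x y) K = idsum (idscale x K) (idscale y K).
Proof.
move=> iK; apply/seteqP; split.
  apply: ideal_mul_sub; first exact: is_ideal_combine.
  move=> _ k [_ [_ [[a _ <-] [b _ <-] ->]]] Kk.
  exists (x * (a * k)), (y * (b * k)); split; last by ring.
    by exists (a * k) => //; exact: idealM.
  by exists (b * k) => //; exact: idealM.
apply: sum_sub; first exact: is_ideal_mul.
  by apply: scale_sub => k Kk; apply: ideal_mul_mem => //; exact: pair_idealL.
by apply: scale_sub => k Kk; apply: ideal_mul_mem => //; exact: pair_idealR.
Qed.

Lemma product_ideal_r0 I J r : is_ideal I -> product_ideal I J r 0 = ideal_exp I r.
Proof. by move=> iI; apply: ideal_mulT; exact: is_ideal_exp. Qed.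

Lemma product_ideal_0s I J s : is_ideal J -> product_ideal I J 0 s = ideal_exp J s.
Proof. by move=> iJ; rewrite product_idealC product_ideal_r0. Qed.

End Products.

Section CMLengths.
Variables (R : comNzRingType) (m : set R).
Hypothesis hR : cohen_macaulay_local m.
Implicit Types (I J K L D B : set R) (x y z : R).

Let hloc : noetherian_local m. Proof. by case: hR. Qed.

(** As [x] is regular, [B] has the same colength in [(x)] as [K] has in [R]. *)
Lemma cm_len_scale x K B : krull_dim R 1 -> is_ideal K -> is_ideal B ->
  finite_length B -> finite_length K -> B = idscale x K ->
  finite_length (principal x) /\
  (length_quot (principal x) + length_quot K <= length_quot B)%N.
Proof.
move=> hd iK iB fB fK EB; have ip := is_ideal_principal x.
have Bx : B `<=` principal x by rewrite EB => _ [a _ <-]; exact: principal_mem.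
have fx : finite_length (principal x) by exact: finite_length_sub fB.
have rx := cm_regular1 hR hd fx; split=> //.
rewrite (len_principal_split x iB fB); apply: leq_add; apply: len_sub => //.
- exact: is_ideal_sum.
- exact: sum_sub.
- by apply: finite_length_sub fB => //; [exact: is_ideal_sum | exact: sub_sumR].
- exact: is_ideal_colon.
- rewrite /colon EB => a [k Kk /eqP]; rewrite -subr_eq0 -mulrBr => /eqP/rx/eqP.
  by rewrite subr_eq0 => /eqP <-.
- exact: finite_length_colon.
Qed.

(** With [B], [K], [L], [D] the members of a filtration in degrees [(r+1, s+1)],
    [(r, s+1)], [(r+1, s)], [(r, s)], the colength of [(x, z)] is thus at most the
    mixed second difference of the Hilbert function. *)
Lemma cm_len_combine x z K L D B : krull_dim R 2 -> m z ->
  is_ideal K -> is_ideal L -> is_ideal D -> is_ideal B ->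
  finite_length K -> finite_length L -> finite_length D -> finite_length B ->
  (forall a, D a -> L (x * a)) -> (forall a, D a -> K (z * a)) ->
  B = idsum (idscale x K) (idscale z L) ->
  finite_length (pair_ideal x z) /\
  (length_quot (pair_ideal x z) + length_quot K + length_quot L <=
     length_quot B + length_quot D)%N.
Proof.
move=> hd mz iK iL iD iB fK fL fD fB DL DK EB.
have fxz : finite_length (pair_ideal x z).
  apply: finite_length_sub fB => //; first exact: is_ideal_pair.
  by rewrite EB; apply: sumS => _ [a _ <-]; exact: principal_mem.
have [rx rz] := cm_regular2 hR hd mz fxz.
by split=> //; rewrite EB; exact: len_combine_ge.
Qed.

(** For a parameter ideal [I] the module [I / I^2] is free of rank two over [R/I]. *)
Lemma cm_len_square I : krull_dim R 2 -> m_primary m I -> generated_by_sop m I ->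
  length_quot (ideal_exp I 2) = (3 * length_quot I)%N.
Proof.
move=> hd hI [s [[hs _] EI]].
have : size s = 2 by exact: max_chain_uniq hs hd.
case: s EI {hs} => [|x [|y [|? ?]]] //; rewrite ideal_gen2 => EI _.
have iI := m_primary_ideal hI; have fI := m_primary_finite_length hloc hI.
have Ix : I x by rewrite EI; exact: pair_idealL.
have Iy : I y by rewrite EI; exact: pair_idealR.
have E2 : ideal_exp I 2 = idsum (idscale x I) (idscale y I).
  rewrite -ideal_mul_pair // -EI.
  by rewrite -[ideal_exp I 2]/(ideal_mul I (ideal_exp I 1)) ideal_expS1.
have fxy : finite_length (pair_ideal x y) by rewrite -EI.
have [f2 le2] := len_combine_le iI iI fxy fI fI.
have [|||_ ge2] := @cm_len_combine x y I I setT (ideal_exp I 2) hd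
  (m_primary_sub hI Iy) iI iI (@is_ideal_setT R) (is_ideal_exp _ _) fI fI
  (finite_length_setT R) _ _ _ E2.
- by rewrite E2.
- by move=> a _; exact: idealMr.
- by move=> a _; exact: idealMr.
rewrite -EI -E2 in le2; rewrite -EI len_setT in ge2; lia.
Qed.

End CMLengths.

Section Main.
Variables (R : comNzRingType) (m : set R).
Hypothesis hR : cohen_macaulay_local m.
Hypothesis hk : infinite_set (residue_ring m).
Variables (I J : set R).
Hypotheses (hI : m_primary m I) (hJ : m_primary m J).
Variable F : int * int -> set R.
Hypothesis hF : admissible_filtration I J F.

Let hloc : noetherian_local m. Proof. by case: hR. Qed.
Let iI : is_ideal I. Proof. exact: m_primary_ideal hI. Qed.
Let iJ : is_ideal J. Proof. exact: m_primary_ideal hJ. Qed.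
Let Im : I `<=` m. Proof. exact: m_primary_sub. Qed.
Let Jm : J `<=` m. Proof. exact: m_primary_sub. Qed.

Local Notation G := (nat_filtration F).
Local Notation H r s := (length_quot (G r s)).

Let iG r s : is_ideal (G r s). Proof. exact: nat_filtration_ideal hF r s. Qed.

Lemma finite_length_filtration r s : finite_length (G r s).
Proof.
apply: finite_length_sub (product_sub_filtration hF (r := r) (s := s)) _ => //.
  exact: is_ideal_product.
apply: (finite_length_mul hloc); try exact: is_ideal_exp.
  by apply: (finite_length_exp hloc) => //; exact: m_primary_finite_length hI.
by apply: (finite_length_exp hloc) => //; exact: m_primary_finite_length hJ.
Qed.

Let fG := finite_length_filtration.
Let mG := filtration_mul hF.
Let G00 := filtration00 hF.

Lemma filtration_gen1 a : I a -> G 1 0 a.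
Proof. by move=> Ia; apply: (product_sub_filtration hF); exact: product_ideal10. Qed.

Lemma filtration_gen2 a : J a -> G 0 1 a.
Proof. by move=> Ja; apply: (product_sub_filtration hF); exact: product_ideal01. Qed.

Lemma filtration_int : (forall r s, G r s `<=` product_ideal I J r s) ->
  forall r s : int, F (r, s) = product_powers I J (r, s).
Proof.
move=> h r s; have [_ [_ _ _ Fmax _]] := hF; rewrite Fmax.
have maxP (A : set R) (n : int) : exists k : nat,
    Num.max n 0 = k%:Z /\ ideal_expz A n = ideal_exp A k.
  by case: n => n; [exists n | exists 0%N].
have [i [-> Ei]] := maxP I r; have [j [-> Ej]] := maxP J s.
rewrite /product_powers /= Ei Ej; apply/seteqP; split; first exact: h.
exact: product_sub_filtration.
Qed.

Lemma tail_exists (P : nat -> nat -> int) N0 :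
  (forall r s, (N0 <= r)%N -> (N0 <= s)%N -> P r s = (H r s)%:Z) ->
  exists N, let M := tail F N in
  [/\ rees_family I J M, forall r s, finite_length (M r s),
      forall r s, M r.+1 s `<=` ideal_mul I (M r s),
      forall r s, M r s.+1 `<=` ideal_mul J (M r s)
    & forall r s, (length_quot (M r s))%:Z = P (r + N)%N (s + N)%N].
Proof.
move=> HP; have [N1 hN1] := filtration_step hF.
exists (N0 + N1)%N => M.
have hI1 r s : M r.+1 s `<=` ideal_mul I (M r s).
  by rewrite /M /tail addSn; apply: (hN1 _ _).1; lia.
have hJ1 r s : M r s.+1 `<=` ideal_mul J (M r s).
  by rewrite /M /tail addSn; apply: (hN1 _ _).2; lia.
split=> //; first exact: rees_tail.
- by move=> r s; exact: fG.
- by move=> r s; rewrite HP //; lia.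
Qed.

(** The ideal [m M] contains [A M], and [A M(r, s)] contains [M(r+1, s)]. *)
Lemma gap_le M (A B : set R) r s : rees_family A B M -> A `<=` m ->
  (forall r s, finite_length (M r s)) ->
  (forall r s, M r.+1 s `<=` ideal_mul A (M r s)) ->
  (gap M (max_multiple m M) r s <= length_quot (M r.+1 s) - length_quot (M r s))%N.
Proof.
move=> [iM _ _] Am fM stepA; apply: leq_sub2r; apply: len_sub => //.
  exact: is_ideal_mul.
by apply: subset_trans (@stepA r s) _; exact: ideal_mulS.
Qed.

(** The lengths of [M / m M] are bounded by the slope [a], so that a generic
    element [x] of [A] satisfies [M(r+1, 0) = x M(r, 0)] for some [r], and then
    [cm_len_scale] bounds its colength. *)
Lemma reduction_one (A B : set R) M (a : int) : krull_dim R 1 ->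
  is_ideal A -> is_ideal B -> A `<=` m -> rees_family A B M ->
  (forall r s, finite_length (M r s)) ->
  (forall r s, M r.+1 s `<=` ideal_mul A (M r s)) ->
  (forall r, (length_quot (M r.+1 0%N))%:Z - (length_quot (M r 0%N))%:Z = a) ->
  exists x, [/\ A x, finite_length (principal x)
    & (length_quot (principal x))%:Z <= a].
Proof.
move=> hd iA iB Am hM fM stepA Ha; have [iM _ cM] := hM.
have bC r : (gap M (max_multiple m M) r 0 <= `|a|)%N.
  apply: leq_trans (gap_le r 0%N hM Am fM stepA) _.
  by have := Ha r; lia.
have [x Ax [r hr]] := generic_ex hloc hk iA
  (generic_reduction_bounded hloc iA iB hM fM bC).
have E : M r.+1 0%N = idscale x (M r 0%N).
  apply/seteqP; split=> //; apply: scale_sub => b Mb.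
  by have := cM r 0%N 1%N 0%N x b; apply=> //; exact: product_ideal10.
have [fx lx] := cm_len_scale hR hd (iM r 0%N) (iM r.+1 0%N) (fM _ _) (fM _ _) E.
by exists x; split=> //; have := Ha r; lia.
Qed.

Section One.
Variable e : nat -> nat -> int.
Hypothesis hd : krull_dim R 1.
Hypothesis he : hilbert_coefficients 1 F e.
Hypothesis e00 : e 0%N 0%N = 0.

Theorem equality_one :
  [/\ generated_by_sop m I, generated_by_sop m J,
      forall r s, hilbert_poly 1 e r s = (H r s)%:Z
    & forall r s, G r s `<=` product_ideal I J r s].
Proof.
have [N0 hN0] := he.
have [N [hM fM sI sJ LM]] := tail_exists (P := hilbert_poly 1 e) hN0.
have [|x [Ix fx lx]] := reduction_one (a := e 1%N 0%N) hd iI iJ Im hM fM sI.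
  by move=> r; rewrite !LM addSn hilbert_poly1_diff.
have [|z [Jz fz lz]] := @reduction_one J I (fun r s => tail F N s r) (e 0%N 1%N) hd iJ iI Jm
    (rees_swap hM) (fun r s => fM s r) (fun r s => @sJ s r).
  by move=> s; rewrite !LM addSn hilbert_poly1_diff.
have Gx := filtration_gen1 Ix; have Gz := filtration_gen2 Jz.
have EP r s : e 1%N 0%N * r%:Z + e 0%N 1%N * s%:Z = hilbert_poly 1 e r s.
  by rewrite hilbert_poly1 e00 subr0.
have [|hP [hr hs]] := rigidity_one iG fG mG G00 Gx Gz fx fz lx lz (N := N0).
  by move=> r s hr hs; rewrite EP hN0.
have EI : I = ideal_gen [set` [:: x]].
  rewrite ideal_gen1; apply/seteqP; split; last exact: principal_sub.
  by move=> a /filtration_gen1; rewrite hr G00.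
have EJ : J = ideal_gen [set` [:: z]].
  rewrite ideal_gen1; apply/seteqP; split; last exact: principal_sub.
  by move=> a /filtration_gen2; rewrite hs G00.
split.
- by exists [:: x]; split=> //; split=> //; rewrite -EI.
- by exists [:: z]; split=> //; split=> //; rewrite -EJ.
- by move=> r s; rewrite -EP; exact: hP.
elim=> [|r IH] s.
  elim: s => [|s IH]; first by rewrite product_ideal00.
  rewrite hs; apply: scale_sub => a /IH ha.
  by have := product_ideal_mul (product_ideal01 (I := I) Jz) ha; rewrite add0n add1n.
rewrite hr; apply: scale_sub => a /IH ha.
by have := product_ideal_mul (product_ideal10 (J := J) Ix) ha; rewrite add0n add1n.
Qed.

End One.

Section Two.
Variable e : nat -> nat -> int.
Hypothesis hd : krull_dim R 2.
Hypothesis he : hilbert_coefficients 2 F e.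
Hypotheses (e10 : e 1%N 0%N = 0) (e01 : e 0%N 1%N = 0).

(** The second differences of the Hilbert polynomial in the directions [(2, 0)],
    [(1, 1)] and [(0, 2)] are [e_20], [e_11] and [e_02]; they bound the colengths
    of the pairs of a joint reduction by [cm_len_combine]. *)
Lemma joint_reductions_two : exists x y z w, [/\ I x, I y, J z & J w] /\
  [/\ finite_length (pair_ideal x y) /\ (length_quot (pair_ideal x y))%:Z <= e 2%N 0%N,
      finite_length (pair_ideal x z) /\ (length_quot (pair_ideal x z))%:Z <= e 1%N 1%N,
      finite_length (pair_ideal w y) /\ (length_quot (pair_ideal w y))%:Z <= e 1%N 1%N
    & finite_length (pair_ideal w z) /\ (length_quot (pair_ideal w z))%:Z <= e 0%N 2%N].
Proof.
have [N0 hN0] := he.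
have [N [hM fM sI sJ LM]] := tail_exists (P := hilbert_poly 2 e) hN0.
set M := tail F N in hM fM sI sJ LM.
pose C := ((`|e 2%N 0%N| + `|e 1%N 1%N|) * N.+1)%N.
have bC r s : (gap M (max_multiple m M) r s <= C * (r + s).+1)%N.
  apply: leq_trans (gap_le r s hM Im fM sI) _.
  have := hilbert_poly2_diff e (r + N) (s + N); rewrite e10 subr0 -addSn -!LM => -[h _].
  have b1 : e 2%N 0%N * (r + N).+1%:Z <= `|e 2%N 0%N|%:Z * (r + N).+1%:Z.
    by apply: ler_wpM2r => //; exact: ler_norm.
  have b2 : e 1%N 1%N * (s + N)%:Z <= `|e 1%N 1%N|%:Z * (s + N)%:Z.
    by apply: ler_wpM2r => //; exact: ler_norm.
  have b3 : (`|e 2%N 0%N| * (r + N).+1 <= `|e 2%N 0%N| * (N.+1 * (r + s).+1))%N.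
    by rewrite leq_mul2l; apply/orP; right; nia.
  have b4 : (`|e 1%N 1%N| * (s + N) <= `|e 1%N 1%N| * (N.+1 * (r + s).+1))%N.
    by rewrite leq_mul2l; apply/orP; right; nia.
  rewrite /C mulnDl mulnDl -!mulnA.
  move: h b1 b2 b3 b4; rewrite -!PoszM; clear; lia.
have [x [y [z [w [n [[Ix Iy Jz Jw] hred]]]]]] := joint_reductions hloc hk iI iJ hM fM sI sJ bC.
have [iM _ cM] := hM.
have mulI i j a b : I a -> M i j b -> M i.+1 j (a * b).
  by move=> Ia Mb; rewrite -[i.+1]add1n -[j]add0n; apply: cM => //; exact: product_ideal10.
have mulJ i j a b : J a -> M i j b -> M i j.+1 (a * b).
  by move=> Ja Mb; rewrite -[j.+1]add1n -[i]add0n; apply: cM => //; exact: product_ideal01.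
have D1 i j := hilbert_poly2_diff e (i + N) (j + N).
have [hxy _ _ _] := hred n.+1 n (leqnSn n) (leqnn n).
have [_ hxz hwy _] := hred n n (leqnn n) (leqnn n).
have [_ _ _ hwz] := hred n n.+1 (leqnn n) (leqnSn n).
exists x, y, z, w; split=> //.
split.
- have [||| fxy lxy] := @cm_len_combine R m hR x y (M n.+1 n) (M n.+1 n) (M n n) (M n.+2 n)
    hd (Im Iy) (iM _ _) (iM _ _) (iM _ _) (iM _ _) (fM _ _) (fM _ _) (fM _ _) (fM _ _).
  + by move=> a; exact: mulI.
  + by move=> a; exact: mulI.
  + by apply/seteqP; split=> //; apply: sum_sub => //; apply: scale_sub => a; exact: mulI.
  split=> //; have := D1 n n; have := D1 n.+1 n.
  rewrite -!addSn -!LM => -[h1 _] [h2 _]; move: lxy h1 h2; rewrite !addSn !intS; clear; lia.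
- have [||| fxz lxz] := @cm_len_combine R m hR x z (M n n.+1) (M n.+1 n) (M n n) (M n.+1 n.+1)
    hd (Jm Jz) (iM _ _) (iM _ _) (iM _ _) (iM _ _) (fM _ _) (fM _ _) (fM _ _) (fM _ _).
  + by move=> a; exact: mulI.
  + by move=> a; exact: mulJ.
  + apply/seteqP; split=> //; apply: sum_sub => //; apply: scale_sub => a; first exact: mulI.
    exact: mulJ.
  split=> //; have := D1 n n; have := D1 n n.+1.
  rewrite -!addSn -!LM => -[h1 _] [h2 _]; move: lxz h1 h2; rewrite !addSn !intS; clear; lia.
- have [||| fwy lwy] := @cm_len_combine R m hR w y (M n.+1 n) (M n n.+1) (M n n) (M n.+1 n.+1)
    hd (Im Iy) (iM _ _) (iM _ _) (iM _ _) (iM _ _) (fM _ _) (fM _ _) (fM _ _) (fM _ _).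
  + by move=> a; exact: mulJ.
  + by move=> a; exact: mulI.
  + apply/seteqP; split=> //; apply: sum_sub => //; apply: scale_sub => a; first exact: mulJ.
    exact: mulI.
  split=> //; have := D1 n n; have := D1 n n.+1.
  rewrite -!addSn -!LM => -[h1 _] [h2 _]; move: lwy h1 h2; rewrite !addSn !intS; clear; lia.
- have [||| fwz lwz] := @cm_len_combine R m hR w z (M n n.+1) (M n n.+1) (M n n) (M n n.+2)
    hd (Jm Jz) (iM _ _) (iM _ _) (iM _ _) (iM _ _) (fM _ _) (fM _ _) (fM _ _) (fM _ _).
  + by move=> a; exact: mulJ.
  + by move=> a; exact: mulJ.
  + by apply/seteqP; split=> //; apply: sum_sub => //; apply: scale_sub => a; exact: mulJ.
  split=> //; have := D1 n n; have := D1 n n.+1.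
  rewrite -!addSn -!LM => -[_ h1] [_ h2]; move: lwz h1 h2; rewrite !addSn !intS; clear; lia.
Qed.

Theorem equality_two :
  [/\ generated_by_sop m I, generated_by_sop m J,
      forall r s, hilbert_poly 2 e r s = (H r s)%:Z
    & forall r s, G r s `<=` product_ideal I J r s].
Proof.
have [N0 hN0] := he.
have [x [y [z [w [[Ix Iy Jz Jw] [[fxy lxy] [fxz lxz] [fwy lwy] [fwz lwz]]]]]]] :=
  joint_reductions_two.
have Gx := filtration_gen1 Ix; have Gy := filtration_gen1 Iy.
have Gz := filtration_gen2 Jz; have Gw := filtration_gen2 Jw.
have EP r s : e 2%N 0%N * 'C(r.+1, 2)%:Z + e 1%N 1%N * (r%:Z * s%:Z)
    + e 0%N 2%N * 'C(s.+1, 2)%:Z + e 0%N 0%N = hilbert_poly 2 e r s.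
  by rewrite hilbert_poly2 e10 e01 !mul0r !subr0.
have [|hP [hr hs]] := rigidity_two iG fG mG G00 Gx Gy Gz Gw fxy fxz fwy fwz
    lxy lxz lwy lwz (e := e 0%N 0%N) (N := N0).
  by move=> r s hr hs; rewrite EP hN0.
have EI : I = ideal_gen [set` [:: x; y]].
  rewrite ideal_gen2; apply/seteqP; split; last exact: pair_ideal_sub.
  by move=> a /filtration_gen1; rewrite hr G00 expr1 expr0 mulr1.
have EJ : J = ideal_gen [set` [:: w; z]].
  rewrite ideal_gen2; apply/seteqP; split; last exact: pair_ideal_sub.
  by move=> a /filtration_gen2; rewrite hs G00 expr1 expr0 mulr1.
split.
- by exists [:: x; y]; split=> //; split=> //; rewrite -EI.
- by exists [:: w; z]; split=> //; split=> //; rewrite -EJ.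
- by move=> r s; rewrite -EP; exact: hP.
have iP := is_ideal_product I J.
elim=> [|r IH] s.
  elim: s => [|s IH]; first by rewrite product_ideal00.
  rewrite hs; apply: sum_sub => //.
    apply: scale_sub => a /IH ha.
    by have := product_ideal_mul (product_ideal01 (I := I) Jw) ha; rewrite add0n add1n.
  rewrite expr0 mulr1; apply: principal_sub => //; rewrite -(mul1r (z ^+ _)).
  by apply: product_ideal_mem => //; exact: ideal_exp_mem.
rewrite hr; apply: sum_sub => //.
  apply: scale_sub => a /IH ha.
  by have := product_ideal_mul (product_ideal10 (J := J) Ix) ha; rewrite add0n add1n.
by apply: principal_sub => //; apply: product_ideal_mem; exact: ideal_exp_mem.
Qed.

End Two.

Lemma vanishing_two e : krull_dim R 2 -> generated_by_sop m I -> generated_by_sop m J ->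
  (forall r s, hilbert_poly 2 e r s = (H r s)%:Z) ->
  (forall r s, G r s = product_ideal I J r s) ->
  [/\ e 0%N 0%N = 0, e 1%N 0%N = 0 & e 0%N 1%N = 0].
Proof.
move=> hd sI sJ hP hG.
have h00 := hP 0%N 0%N; rewrite G00 len_setT hilbert_poly2 in h00.
have h10 := hP 1%N 0%N; rewrite hG product_ideal_r0 // ideal_expS1 // hilbert_poly2 in h10.
have h20 := hP 2%N 0%N; rewrite hG product_ideal_r0 // hilbert_poly2 in h20.
have h01 := hP 0%N 1%N; rewrite hG product_ideal_0s // ideal_expS1 // hilbert_poly2 in h01.
have h02 := hP 0%N 2%N; rewrite hG product_ideal_0s // hilbert_poly2 in h02.
rewrite (cm_len_square hR hd hI sI) in h20; rewrite (cm_len_square hR hd hJ sJ) in h02.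
have C1 : 'C(1, 2) = 0%N by [].
have C2 : 'C(2, 2) = 1%N by [].
have C3 : 'C(3, 2) = 3%N by [].
move: h00 h10 h20 h01 h02; rewrite C1 C2 C3; clear; split; lia.
Qed.

End Main.

Theorem theorem1p11 (R : comNzRingType) (m : set R) (d : nat)
    (hR : cohen_macaulay_local m) (hdim : krull_dim R d)
    (hd : (1 <= d <= 2)%N)
    (hk : infinite_set (residue_ring m))
    (I J : set R) (hI : m_primary m I) (hJ : m_primary m J)
    (F : int * int -> set R) (hF : admissible_filtration I J F)
    (e : nat -> nat -> int) (he : hilbert_coefficients d F e) :
  [<-> e d.-1 0%N = 0 /\ e 0%N d.-1 = 0;
       [/\ generated_by_sop m I,
           generated_by_sop m J,
           forall r s : nat,
             hilbert_poly d e r s = (hilbert_function F r s)%:Z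
         & forall r s : int, F (r, s) = product_powers I J (r, s)];
       forall a b : nat, (a + b <= d.-1)%N -> e a b = 0].
Proof.
tfae.
- case: d hdim hd he => [|[|[|//]]] // hdim _ he [e1 e2].
    have [sI sJ hP hG] := equality_one hR hk hI hJ hF hdim he e1.
    by split=> //; exact: filtration_int hF hG.
  have [sI sJ hP hG] := equality_two hR hk hI hJ hF hdim he e1 e2.
  by split=> //; exact: filtration_int hF hG.
- case: d hdim hd {he} => [|[|[|//]]] // hdim _ [sI sJ hP hG] a b.
    case: a b => [|a] [|b] //= _; have := hP 0%N 0%N.
    rewrite /hilbert_function -[F _]/(nat_filtration F 0 0) (filtration00 hF).
    by rewrite len_setT hilbert_poly1; lia.
  have [e00 e10 e01] := vanishing_two hR hI hJ hF hdim sI sJ hP (fun r s => hG r%:Z s%:Z).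
  by case: a b => [|[|a]] [|[|b]] //=; lia.
- by move=> h; split; apply: h; rewrite ?addn0.
Qed.
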